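(* For all real $\gamma$ with $1/2<\gamma<1$, all real $\delta>0$ and every positive integer $d$, there exists a constant $K=K_{\gamma,\delta,d}$ with the following property. Let $G$ be a regular $n$-vertex graph of degree at most $d$ such that for every subset $A$ of vertices with $|A|\leq n/2$ there exist at least $\delta|A|^{\gamma}$ edges between $A$ and its complement $A^{c}$. Then $\tau^{*}\leq K n$, where $\tau^{*}$ is the maximal mean commute time of the continuous-time random walk on $G$.
   Context: Graphs are finite and undirected. The continuous-time random walk on $G$ is defined as follows: every edge carries an alarm clock with independent exponential (rate $1$) ringing times, and the walker at a vertex moves along the first incident edge that rings, at the time it rings (so the walk crosses each edge incident to its current vertex at rate $1$). For vertices $v,u$, $E_vT_u$ denotes the expected (continuous) time for the walk started at $v$ to hit $u$. The maximal mean commute time is $\tau^{*}=\max_{v,u}\,(E_vT_u+E_uT_v)$, the maximum being over all pairs of vertices of $G$. *)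

(* Defs.v *)
From mathcomp Require Import all_boot all_order all_algebra.
From mathcomp Require Import all_classical all_reals all_analysis.

Set Implicit Arguments.
Unset Strict Implicit.
Unset Printing Implicit Defensive.

Import Order.TTheory GRing.Theory Num.Theory.
Local Open Scope classical_set_scope.
Local Open Scope ring_scope.

Section Graph.
Context {V : finType} (e : rel V).

Definition edges : {set {set V}} :=
  [set [set p.1; p.2]%SET | p in [pred p : V * V | e p.1 p.2]]%SET.

Definition degree (x : V) : nat := #|[set y | e x y]%SET|.

Definition edge_boundary (A : {set V}) : {set {set V}} :=
  [set [set x; y]%SET | x in A, y in [pred y | (y \notin A) && e x y]]%SET.

End Graph.

(* Mutual independence of the random variables X i, i ranging over D: the
   product rule holds for every finite subfamily. *)
Definition mutually_independent (R : realType) (disp : measure_display)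
    (Om : measurableType disp) (P : probability Om R) (I : eqType)
    (D : set I) (X : I -> {RV P >-> R}) : Prop :=
  forall (s : seq I) (B : I -> set R),
    uniq s -> (forall i, i \in s -> D i) -> (forall i, measurable (B i)) ->
    P [set w | forall i, i \in s -> B i (X i w)] =
      (\prod_(i <- s) P (X i @^-1` B i))%E.

(* xi (a, j) is the time between the j-th and the (j+1)-st ring of the clock of
   the edge a (xi (a, 0) is the time of its first ring).  Only the values of xi
   at edges of the graph are constrained and used. *)
Definition alarm_clocks (R : realType) (V : finType) (e : rel V)
    (disp : measure_display) (Om : measurableType disp) (P : probability Om R)
    (xi : {set V} * nat -> {RV P >-> R}) : Prop :=
  mutually_independent [set i | i.1 \in edges e] xi /\
  (forall a j, a \in edges e ->
     forall B : set R, measurable B ->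
       distribution P (xi (a, j)) B = exponential_prob 1 B).

Section Walk.
Context {R : realType} {V : finType} (e : rel V).
Context {disp : measure_display} {Om : measurableType disp}.
Context {P : probability Om R} (xi : {set V} * nat -> {RV P >-> R}).

Definition ring_time (a : {set V}) (j : nat) (w : Om) : R :=
  \sum_(i < j.+1) xi (a, val i) w.

(* First ring of the clock of a strictly after time t (+oo if there is none). *)
Definition next_ring (a : {set V}) (t : \bar R) (w : Om) : \bar R :=
  ereal_inf [set (ring_time a j w)%:E |
              j in [set j | (t < (ring_time a j w)%:E)%E]].

(* First ring strictly after time t among the edges incident to x. *)
Definition next_jump (x : V) (t : \bar R) (w : Om) : \bar R :=
  \big[mine/+oo%E]_(y | e x y) next_ring [set x; y]%SET t w.

(* A state (x, t) means that the walker has arrived at x at time t.  Ties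
   between clocks have probability 0 and are broken arbitrarily; an isolated
   vertex is never left. *)
Definition walk_step (w : Om) (s : V * \bar R) : V * \bar R :=
  let t := next_jump s.1 s.2 w in
  (odflt s.1 [pick y | e s.1 y && (next_ring [set s.1; y]%SET s.2 w == t)], t).

Definition walk (v : V) (w : Om) (m : nat) : V * \bar R :=
  iter m (walk_step w) (v, 0%E).

(* +oo if u is never visited; 0 if u = v. *)
Definition hitting_time (v u : V) (w : Om) : \bar R :=
  ereal_inf [set (walk v w m).2 | m in [set m | (walk v w m).1 = u]].

Definition mean_hitting_time (v u : V) : \bar R :=
  (\int[P]_w hitting_time v u w)%E.

Definition max_mean_commute_time : \bar R :=
  \big[maxe/-oo%E]_(p : V * V)
    (mean_hitting_time p.1 p.2 + mean_hitting_time p.2 p.1)%E.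

End Walk.

(* Main.v *)
From HB Require Import structures.
Require Import Defs.
From mathcomp Require Import all_boot all_order all_algebra.
From mathcomp Require Import all_classical all_reals all_analysis.
From mathcomp Require Import measurable_realfun exponential_distribution.
From mathcomp Require Import ring lra.

Set Implicit Arguments.
Unset Strict Implicit.
Unset Printing Implicit Defensive.

Import Order.TTheory GRing.Theory Num.Theory.
Import numFieldNormedType.Exports.
Local Open Scope classical_set_scope.
Local Open Scope ring_scope.

(** The clocks of all edges are followed together.  By memorylessness, every
    ring is the ring of a uniformly chosen edge of the edge set [E], independent
    of the past, and the waiting time before it has mean [1 / #|E|]; the walker
    moves when that edge is incident to its position.  This is established by
    computing, for each finite sequence of rings, the probability that the
    process starts with it, the product weight [exp (- elapsed time)] of the
    clocks being the conditional probability that they have not rung yet.  Hence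
    the mean hitting time of [u] is at most a constant times the Green function
    [f] of the jump chain killed at [u], whose truncations satisfy [f u = 0] and
    [sum_(y ~ x) (f x - f y) <= 1] for [x != u].

    For such an [f] the total drop across the boundary of [A = {f > t}] is at most
    [#|A|], so half of the [B] boundary edges carry a drop of at most
    [2 #|A| / B]: raising [t] by that amount removes at least [B / (2 d)] vertices
    from [A].  With [B >= delta m^gamma], [m] the size of the smaller side, the
    increments of [t] add up to [O(n)]: while [#|A| <= n / 2] each increment is
    bounded by a constant times the number of removed vertices, since
    [#|A|^(1 - gamma) <= #|A|^gamma]; while [#|A| > n / 2] they are bounded, with
    [b = n - #|A|], by [n] times the decrease of a multiple of
    [b^(1 - 2 gamma)], since [2 gamma > 1]. *)

(** * Integration against a measure given by a density *)

Section density.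
Local Open Scope ereal_scope.
Context d (T : measurableType d) (R : realType).
Variables (mu nu : {measure set T -> \bar R}) (g : T -> R).
Hypotheses (mg : measurable_fun setT g) (g0 : forall x, (0 <= g x)%R).
Hypothesis nuE : forall A, measurable A -> nu A = \int[mu]_(x in A) (g x)%:E.

Import HBNNSimple.

Let mEg : measurable_fun [set: T] (fun x => (g x)%:E).
Proof. exact/measurable_EFinP. Qed.

Let integral_density_indic (A : set T) : measurable A ->
  \int[nu]_x (\1_A x)%:E = \int[mu]_x ((\1_A x)%:E * (g x)%:E).
Proof.
move=> mA; rewrite integral_indic// setIT nuE// integral_mkcond.
apply: eq_integral => x _; rewrite patchE indicE.
by case: (x \in A); rewrite ?mul1e ?mul0e.
Qed.

Let integral_density_nnsfun (f : {nnsfun T >-> R}) :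
  \int[nu]_x (f x)%:E = \int[mu]_x ((f x)%:E * (g x)%:E).
Proof.
under [LHS]eq_integral do rewrite fimfunE -fsumEFin//.
rewrite [LHS]ge0_integral_fsum//; last 2 first.
  - by move=> r; exact/measurable_EFinP/measurableT_comp.
  - by move=> n x _; rewrite EFinM nnfun_muleindic_ge0.
under [RHS]eq_integral.
  move=> x xD; rewrite fimfunE -fsumEFin// muleC ge0_mule_fsumr; last first.
    by move=> r; rewrite EFinM nnfun_muleindic_ge0.
  over.
rewrite [RHS]ge0_integral_fsum//; last 2 first.
  - by move=> r; apply: emeasurable_funM => //; exact/measurable_EFinP/measurableT_comp.
  - by move=> n x _; apply: mule_ge0; rewrite ?EFinM ?nnfun_muleindic_ge0// lee_fin.
apply: eq_fsbigr => r /[!inE] /= -[t _ <-].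
under eq_integral do rewrite EFinM.
have mi : measurable_fun [set: T] (fun x => (\1_(f @^-1` [set f t]) x)%:E : \bar R).
  exact/measurable_EFinP/measurable_indic.
rewrite ge0_integralZl ?lee_fin// integral_density_indic// -ge0_integralZl ?lee_fin//.
- by apply: eq_integral => x _; rewrite EFinM muleA muleC.
- by apply: emeasurable_funM => //; exact/measurable_EFinP/measurable_indic.
- by move=> x _; rewrite mule_ge0// lee_fin.
Qed.

(** Usual extension: indicators by hypothesis, simple functions by linearity, then the monotone
    limit along [nnsfun_approx]. *)
Lemma ge0_integral_density (f : T -> \bar R) : measurable_fun setT f ->
  (forall x, 0 <= f x) -> \int[nu]_x f x = \int[mu]_x (f x * (g x)%:E).
Proof.
move=> mf f0; pose f_ := nnsfun_approx measurableT mf.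
have fE x : limn (fun n => (f_ n x)%:E) = f x.
  by apply/cvg_lim => //; exact: cvg_nnsfun_approx.
have nd x : {homo (fun n => (f_ n x)%:E) : n m / (n <= m)%N >-> n <= m}.
  by move=> m n mn; rewrite lee_fin; exact/lefP/nd_nnsfun_approx.
under [LHS]eq_integral do rewrite -fE.
rewrite monotone_convergence//; last 2 first.
- by move=> n; exact/measurable_EFinP.
- by move=> n x _; rewrite lee_fin.
transitivity (\int[mu]_x limn (fun n => (f_ n x)%:E * (g x)%:E)); last first.
  apply: eq_integral => x _; rewrite muleC -fE -limeMl//.
    by apply: congr_lim; apply/funext => n /=; rewrite muleC.
  exact/ereal_nondecreasing_is_cvgn/nd.
rewrite monotone_convergence//.
- by apply: congr_lim; apply/funext => n; exact: integral_density_nnsfun.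
- by move=> n; apply: emeasurable_funM => //; exact/measurable_EFinP.
- by move=> n x _; rewrite mule_ge0 ?lee_fin.
- by move=> x _ m n mn; rewrite lee_wpmul2r ?nd// lee_fin.
Qed.

End density.

(** * Exponential integrals over half-lines *)

Section exponential.
Context {R : realType}.
Local Notation mu := (@lebesgue_measure R).

Lemma integral_expR_tail (c r k : R) : 0 < r ->
  (\int[mu]_(x in `[c, +oo[) (expR (k - r * x))%:E =
   (expR (k - r * c) / r)%:E)%E.
Proof.
move=> r0; pose F (x : R) := - (expR (k - r * x) / r).
have r_neq0 : r != 0 by rewrite gt_eqF.
have dF (x : R) : is_derive x 1 F (expR (k - r * x)).
  by apply: is_derive_eq; rewrite /GRing.scale/=; field.
have cF : continuous (fun x : R => expR (k - r * x)).
  move=> x; have : is_derive x 1 (fun x : R => expR (k - r * x)) (- r * expR (k - r * x)).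
    by apply: is_derive_eq; rewrite /GRing.scale/=; ring.
  by move=> /@ex_derive/derivable1_diffP/differentiable_continuous.
rewrite (@ge0_continuous_FTC2y _ _ F _ 0)//.
- by rewrite /F EFinN oppeK add0e.
- exact: continuous_subspaceT.
- have H : expR (- (r * x)) @[x --> +oo] --> (0 : R).
    apply: (@cvg_comp _ _ _ (fun z => r * z) (fun z => expR (- z)) _ (pinfty_nbhs R)).
      exact: gt0_cvgMry.
    exact: cvgr_expR.
  rewrite (_ : F = (fun x => - (expR k / r) * expR (- (r * x)))); last first.
    by apply/funext => x; rewrite /F expRD; field.
  by rewrite -(mulr0 (- (expR k / r))); apply: cvgM => //; exact: cvg_cst.
- apply: cvg_at_right_filter; apply: differentiable_continuous.
  exact/derivable1_diffP/ex_derive.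
- by move=> x _; rewrite derive1E; apply: derive_val.
Qed.

End exponential.

(** * Independence of one variable from the sigma-algebra of the others *)

Section independence.
Context {R : realType} {disp : measure_display} {Om : measurableType disp}.
Context {P : probability Om R} {I : eqType}.
Variables (D : set I) (X : I -> {RV P >-> R}).

Definition cylinders (Q : set I) : set (set Om) :=
  [set A | exists s : seq I, exists B : I -> set R,
     [/\ uniq s, forall i, i \in s -> Q i, forall i, measurable (B i) &
         A = [set w | forall i, i \in s -> B i (X i w)]]].

Lemma measurable_cylinders Q : cylinders Q `<=` measurable.
Proof.
move=> _ [s [B [_ _ mB ->]]].
elim: s => [|i s IHs]; first by rewrite (_ : [set w | _] = setT)// -subTset.
rewrite (_ : [set w | _] =
    X i @^-1` B i `&` [set w | forall i, i \in s -> B i (X i w)]); last first.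
  apply/seteqP; split=> w /= H; last first.
    by move=> k; rewrite inE => /predU1P[->|]; [case: H|exact: H.2].
  by split=> [|k ks]; apply: H; rewrite inE ?eqxx ?ks ?orbT.
by apply: measurableI => //; rewrite -[_ @^-1` _]setTI; exact: measurable_funP.
Qed.

Lemma cylinders_setT Q : cylinders Q setT.
Proof.
by exists [::], (fun=> setT); split => //; apply/seteqP; split.
Qed.

Lemma cylinders_setI Q : setI_closed (cylinders Q).
Proof.
move=> _ _ [s [B [us sQ mB ->]]] [s' [B' [us' sQ' mB' ->]]].
exists (undup (s ++ s')), (fun i => (if i \in s then B i else setT) `&`
  (if i \in s' then B' i else setT)); split.
- exact: undup_uniq.
- by move=> i; rewrite mem_undup mem_cat => /orP[/sQ|/sQ'].
- by move=> i; apply: measurableI; case: ifP.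
- apply/seteqP; split=> w /=.
    move=> [Hs Hs'] i _; split; case: ifP => // is_; [exact: Hs|exact: Hs'].
  move=> H; split=> i is_; have := H i; rewrite mem_undup mem_cat is_ ?orbT.
    by move=> /(_ isT)[].
  by move=> /(_ isT)[].
Qed.

(** The sample space with the sigma-algebra generated by the [X i], [i] in [Q]: measurability on it
    expresses dependence on these variables only. *)
Definition cylType (Q : set I) := g_sigma_algebraType (cylinders Q).

Lemma measurable_cylType Q (A : set Om) :
  measurable (A : set (cylType Q)) -> measurable A.
Proof.
exact: (smallest_sub (@sigma_algebra_measurable _ Om) (@measurable_cylinders Q)).
Qed.

Lemma measurable_fun_cylType Q d' (T' : measurableType d') (f : Om -> T') :
  measurable_fun (setT : set (cylType Q)) f -> measurable_fun setT f.
Proof. by move=> mf _ Y mY; apply: (@measurable_cylType Q); exact: mf. Qed.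

Lemma measurable_RV_cylType (Q : set I) i : Q i ->
  measurable_fun (setT : set (cylType Q)) (X i).
Proof.
move=> Qi _ B mB; rewrite setTI; apply: sub_sigma_algebra.
exists [:: i], (fun=> B); split=> //; first by move=> j; rewrite inE => /eqP->.
apply/seteqP; split => w /=; first by move=> ? j; rewrite inE => /eqP->.
by apply; rewrite inE.
Qed.

Hypothesis indep : mutually_independent D X.

(** As functions of [A], both sides are finite measures that agree on the cylinders, a generating
    class stable under intersection. *)
Lemma independent_cylType (i0 : I) (A : set Om) (B : set R) :
  D i0 -> measurable (A : set (cylType (D `\ i0))) -> measurable B ->
  (P (A `&` X i0 @^-1` B) = P A * P (X i0 @^-1` B))%E.
Proof.
move=> Di0 mA mB; set C := X i0 @^-1` B.
have mC : measurable C by rewrite -[C]setTI; exact: measurable_funP.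
have PC : (P C = (fine (P C))%:E)%E by rewrite fineK// fin_num_measure.
have PC0 : 0 <= fine (P C) by rewrite fine_ge0.
rewrite muleC PC.
apply: (@g_sigma_algebra_measure_unique _ _ _ (cylinders (D `\ i0))
   (@measurable_cylinders _) (fun=> setT) _ _ (mrestr P mC) (mscale (NngNum PC0) P)).
- by move=> _; exact: cylinders_setT.
- by apply/seteqP; split => // x _; exists 0%N.
- exact: cylinders_setI.
- move=> _ [s [B' [us sD mB' ->]]]; set S := [set w | _].
  change (P (S `&` C) = (fine (P C))%:E * P S)%E; rewrite -PC {}/S.
  have i0s : i0 \notin s by apply/negP => /sD[_ /=].
  pose B'' i := if i == i0 then B else B' i.
  have mB'' i : measurable (B'' i) by rewrite /B''; case: ifP.
  have D' i : i \in i0 :: s -> D i by rewrite inE => /predU1P[->//|/sD[]].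
  have := indep (s := i0 :: s) (B := B''); rewrite /= i0s us => /(_ isT D' mB'').
  rewrite big_cons {2}/B'' eqxx -/C => E.
  have sE : (\prod_(i <- s) P (X i @^-1` B'' i) = \prod_(i <- s) P (X i @^-1` B' i))%E.
    apply: eq_big_seq => i si; rewrite /B'' ifF//.
    by apply/negP => /eqP ii0; move: i0s; rewrite -ii0 si.
  rewrite indep//; last by move=> i /sD[].
  rewrite -sE -E; congr (P _); apply/seteqP; split=> w /=.
    move=> [Hs Cw] i; rewrite inE => /predU1P[->|si]; rewrite /B''.
      by rewrite eqxx.
    by rewrite ifF; [exact: Hs|apply/negP => /eqP ii0; move: i0s; rewrite -ii0 si].
  move=> H; split => [i si|].
    have := H i; rewrite inE si orbT /B'' ifF; first exact.
    by apply/negP => /eqP ii0; move: i0s; rewrite -ii0 si.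
  by have := H i0; rewrite inE eqxx /B'' eqxx; exact.
- by move=> _; rewrite ltey_eq fin_num_measure.
- exact: mA.
Qed.

(** The pair [(w, X i0 w)] has a product law once its first component carries only the sigma-algebra
    of the other variables; the equality is then Tonelli's theorem. *)
Lemma integral_independent (i0 : I) (f : cylType (D `\ i0) * R -> \bar R) :
  D i0 -> measurable_fun setT f -> (forall z, 0 <= f z)%E ->
  (\int[P]_w f (w, X i0 w) =
   \int[P]_w \int[distribution P (X i0)]_x f (w, x))%E.
Proof.
move=> Di0 mf f0; set T' := cylType (D `\ i0).
have mid : measurable_fun [set: Om] (id : Om -> T').
  by move=> _ Y mY; rewrite setTI; exact: (@measurable_cylType (D `\ i0)).
pose h (w : Om) : T' * R := (w, X i0 w).
have mh : measurable_fun setT h by apply/measurable_fun_pairP; split => //=.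
pose idm : {mfun Om >-> T'} := HB.pack (id : Om -> T')
   (isMeasurableFun.Build _ _ _ _ _ mid).
pose P' : probability T' R := distribution P idm.
pose nu : probability R R := distribution P (X i0).
pose hm : {mfun Om >-> (T' * R)%type} := HB.pack h
   (isMeasurableFun.Build _ _ _ _ _ mh).
have E A : measurable A -> (P' \x nu)%E A = distribution P hm A.
  apply: product_measure_unique => A' B' mA' mB'.
  by rewrite /nu/= /distribution /pushforward/= -independent_cylType.
have -> : (\int[P]_w f (w, X i0 w) = \int[distribution P hm]_z f z)%E.
  by rewrite ge0_integral_distribution.
rewrite (eq_measure_integral (P' \x nu)%E); last by move=> A mA _; apply/esym/E.
rewrite fubini_tonelli1// ge0_integral_distribution//.
- exact: measurable_fun_fubini_tonelli_F.
- by move=> x; apply: integral_ge0.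
Qed.

End independence.

(** * Memorylessness of an exponential clock *)

Section memoryless.
Context {R : realType} {disp : measure_display} {Om : measurableType disp}.
Context {P : probability Om R} {I : eqType}.
Variables (D : set I) (X : I -> {RV P >-> R}).
Hypothesis indep : mutually_independent D X.

Let integral_exponential_tail (i0 : I) (c r : R) :
    (forall B : set R, measurable B ->
      distribution P (X i0) B = exponential_prob 1 B) ->
    0 <= c -> 0 < r ->
  (\int[distribution P (X i0)]_x
     (if (c < x)%R then expR (- (r - 1) * (x - c)) else 0%R)%:E =
   (expR (- c) / r)%:E)%E.
Proof.
move=> expX c0 r0.
have mu1 : measurable_fun setT (exponential_pdf (1 : R)).
  exact: measurable_exponential_pdf.
(* The identity transports Lebesgue measure from [measurableTypeR R] to the measurable structure of
   [R] that carries the distribution. *)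
pose idR : measurableTypeR R -> R := idfun.
have mid : measurable_fun setT idR := @measurable_id _ _ setT.
unshelve epose (mu := (pushforward (@lebesgue_measure R) idR :
  {measure set R -> \bar R})); first exact: mid.
have pdf0 x : (0 <= (exponential_pdf (1 : R) x)%:E)%E.
  by rewrite lee_fin exponential_pdf_ge0.
pose f x : R := if c < x then expR (- (r - 1) * (x - c)) else 0.
have f0 x : 0 <= f x by rewrite /f; case: ifP.
have mf : measurable_fun setT f.
  apply: measurable_fun_ifT => //; first exact: measurable_fun_ltr.
  by apply: measurableT_comp => //; apply: measurable_funM => //; exact: measurable_funB.
rewrite (@ge0_integral_density _ R _ mu (distribution P (X i0)) _ mu1)//; first last.
- exact/measurable_EFinP.
- move=> A mA; apply: (eq_trans (expX _ mA)); rewrite ge0_integral_pushforward//.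
  by apply/measurable_funTS/measurable_EFinP.
rewrite ge0_integral_pushforward//; first last.
- by move=> x _; rewrite mule_ge0// lee_fin f0.
- by apply: emeasurable_funM; apply/measurable_EFinP.
have -> : expR (- c) / r = expR ((r - 1) * c - r * c) / r.
  by congr (expR _ / _); ring.
rewrite -integral_expR_tail// -integral_itv_obnd_cbnd; last first.
  apply/measurable_funTS/measurable_EFinP; apply: measurableT_comp => //.
  by apply: measurable_funB => //; exact: measurable_funM.
rewrite [RHS]integral_mkcond; apply: eq_integral => x _.
rewrite patchE mem_setE in_itv/= andbT /idR/=; case: ifP => cx; last by rewrite mul0e.
rewrite exponential_pdfE; last exact: le_trans (ltW cx).
by rewrite mul1r -EFinM -expRD; congr (expR _)%:E; ring.
Qed.

(* With [r = 1] this is the memoryless property; the factor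
   [expR (- (r - 1) * (X i0 w - c w))] makes room for the other clocks that are
   required to ring later. *)
Lemma integral_memoryless (i0 : I) (F c : Om -> R) (r : R) : D i0 ->
    (forall B : set R, measurable B ->
      distribution P (X i0) B = exponential_prob 1 B) ->
    measurable_fun (setT : set (cylType X (D `\ i0))) F ->
    measurable_fun (setT : set (cylType X (D `\ i0))) c ->
    (forall w, 0 <= F w) -> (forall w, F w != 0 -> 0 <= c w) -> 0 < r ->
  (\int[P]_w (F w * (if (c w < X i0 w)%R
                     then expR (- (r - 1) * (X i0 w - c w)) else 0))%:E =
   \int[P]_w (F w * (expR (- c w) / r))%:E)%E.
Proof.
move=> Di0 expX mF mc F0 c0 r0.
pose f (z : cylType X (D `\ i0) * R) := (F z.1 * (if (c z.1 < z.2)%R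
                     then expR (- (r - 1) * (z.2 - c z.1)) else 0))%:E.
have mf : measurable_fun setT f.
  have m1 (h : Om -> R) : measurable_fun (setT : set (cylType X (D `\ i0))) h ->
      measurable_fun (setT : set (cylType X (D `\ i0) * R)) (fun z => h z.1).
    by move=> mh; apply: (measurableT_comp mh); exact: measurable_fst.
  have mx : measurable_fun (setT : set (cylType X (D `\ i0) * R)) snd.
    exact: measurable_snd.
  apply/measurable_EFinP; apply: measurable_funM; first exact: m1.
  apply: measurable_fun_ifT => //.
    by apply: measurable_fun_ltr => //; exact: m1.
  apply: measurableT_comp => //; apply: measurable_funM => //.
  by apply: measurable_funB => //; exact: m1.
have f0 z : (0 <= f z)%E.
  by rewrite lee_fin mulr_ge0//; case: ifP => // _; exact: expR_ge0.
rewrite (integral_independent indep Di0 mf f0).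
apply: eq_integral => w _; rewrite /f/=.
(* [c w] is known to be nonnegative only where [F w] is nonzero; elsewhere both sides vanish. *)
have [Fw0|Fw0] := eqVneq (F w) 0.
  by rewrite Fw0 mul0r integral0_eq// => x _; rewrite mul0r.
under eq_integral do rewrite EFinM.
rewrite ge0_integralZl//.
- by rewrite integral_exponential_tail// c0.
- apply/measurable_EFinP/measurable_fun_ifT => //; first exact: measurable_fun_ltr.
  apply: measurableT_comp => //; apply: measurable_funM => //.
  exact: measurable_funB.
- by move=> x _; case: ifP => // _; rewrite lee_fin expR_ge0.
- by rewrite lee_fin.
Qed.

End memoryless.

(** * Histories of rings and their probabilities *)

Section histories.
Context {R : realType} {V : finType} (e : rel V).
Context {disp : measure_display} {Om : measurableType disp}.
Context {P : probability Om R} (xi : {set V} * nat -> {RV P >-> R}).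
Implicit Types (a b : {set V}) (s : seq {set V}) (w : Om).

(* A history lists the edges whose clocks have rung, most recent first. *)

Definition ring_sum b s w : R := \sum_(j < count_mem b s) xi (b, val j) w.

(** [ring_time] counts from 0, so this index is that of the first ring of [b] not recorded in
    [s]. *)
Definition pending_ring b s w : R := ring_time xi b (count_mem b s) w.

Definition clock s w : R := if s is a :: s' then pending_ring a s' w else 0.

(** Age of the clock [b] at the last ring of [s]: the time since its own latest ring, or since 0 if
    there is none. *)
Definition elapsed b s w : R := clock s w - ring_sum b s w.

Fixpoint ordered s w : bool :=
  if s is a :: s' then ordered s' w && (clock s' w < pending_ring a s' w)
  else true.

(** The first rings are those of [s], in that order. Pending clocks are compared with the last time
    only: what is pending then was pending at all earlier rings, see [history_tail]. *)
Definition history s w : bool :=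
  ordered s w && [forall b in edges e, clock s w < pending_ring b s w].

Lemma pending_ringE b s w :
  pending_ring b s w = ring_sum b s w + xi (b, count_mem b s) w.
Proof. by rewrite /pending_ring /ring_time big_ord_recr. Qed.

Lemma ring_sum_cons b a s w :
  ring_sum b (a :: s) w = if a == b then pending_ring a s w else ring_sum b s w.
Proof. by rewrite /ring_sum /=; case: eqP => [->|]. Qed.

Lemma pending_ring_cons b a s w : a != b ->
  pending_ring b (a :: s) w = pending_ring b s w.
Proof. by move=> ab; rewrite /pending_ring /= (negbTE ab). Qed.

Lemma ring_sum_le_clock b s w : ordered s w -> ring_sum b s w <= clock s w.
Proof.
elim: s => [_|a s IHs]; first by rewrite /ring_sum big_ord0.
rewrite [ordered _ _]/= => /andP[/IHs Ls lt_s]; rewrite ring_sum_cons.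
by case: ifP => // _; exact: le_trans Ls (ltW lt_s).
Qed.

Lemma elapsed_ge0 b s w : ordered s w -> 0 <= elapsed b s w.
Proof. by move=> /ring_sum_le_clock; rewrite /elapsed subr_ge0. Qed.

Lemma clock_lt_pending b s w :
  (clock s w < pending_ring b s w) = (elapsed b s w < xi (b, count_mem b s) w).
Proof. by rewrite pending_ringE /elapsed ltrBlDl. Qed.

Lemma elapsed_cons b a s w : elapsed b (a :: s) w =
  if a == b then 0
  else elapsed b s w + (xi (a, count_mem a s) w - elapsed a s w).
Proof.
rewrite /elapsed ring_sum_cons; case: ifP => [|_]; first by rewrite subrr.
by rewrite [clock (_ :: _) _]/= pending_ringE; ring.
Qed.

Lemma history_tail a s w : a \in edges e -> history (a :: s) w -> history s w.
Proof.
move=> aE /andP[/= /andP[os lt_s]] /forall_inP H; rewrite /history os /=.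
apply/forall_inP => b bE; have [<-//|ab] := eqVneq a b.
by apply: (lt_trans lt_s); have := H _ bE; rewrite pending_ring_cons.
Qed.

(** By induction the tails agree; if the latest rings were of different edges, each would strictly
    precede the other. *)
Lemma history_inj s s' w : size s = size s' ->
  all [in edges e] s -> all [in edges e] s' ->
  history s w -> history s' w -> s = s'.
Proof.
elim: s s' => [|a s IHs] [|a' s']//= [] ss' /andP[aE sE] /andP[aE' sE'] h h'.
have ? := IHs _ ss' sE sE' (history_tail aE h) (history_tail aE' h'); subst s'.
have [->//|aa'] := eqVneq a a'; exfalso.
move: h h' => /andP[_ /forall_inP/(_ _ aE')] + /andP[_ /forall_inP/(_ _ aE)].
rewrite !pending_ring_cons// 1?eq_sym// => lt1 lt2.
by have := lt_trans lt1 lt2; rewrite /= ltxx.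
Qed.

Definition weight s w : R := \prod_(b in edges e) expR (- elapsed b s w).

(** Indices of the waiting times used up by [s]. The pending one, [(b, count_mem b s)], is outside,
    hence independent of all that [s] determines. *)
Definition past s : set ({set V} * nat) :=
  [set i | (i.2 < count_mem i.1 s)%N].

(** * Measurability with respect to the waiting times used up *)

Section measurability.
Variable Q : set ({set V} * nat).
Local Notation mQ := (measurable_fun (setT : set (cylType xi Q))).

Lemma measurable_ring_sum b s : past s `<=` Q -> mQ (ring_sum b s).
Proof.
move=> sQ; apply: measurable_sum => j; apply: measurable_RV_cylType.
by apply: sQ; exact: ltn_ord.
Qed.

Lemma past_cons a s : past s `<=` past (a :: s).
Proof.
by move=> [b j] /= js; rewrite /past/= (leq_trans js) ?leq_addl.
Qed.

Lemma measurable_clock s : past s `<=` Q -> mQ (clock s).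
Proof.
case: s => [_|a s sQ]; first exact: measurable_cst.
have -> : clock (a :: s) = ring_sum a (a :: s).
  by apply/funext => w; rewrite ring_sum_cons eqxx.
exact: measurable_ring_sum.
Qed.

Lemma measurable_elapsed b s : past s `<=` Q -> mQ (elapsed b s).
Proof.
by move=> sQ; apply: measurable_funB; [exact: measurable_clock|exact: measurable_ring_sum].
Qed.

Lemma measurable_ordered s : past s `<=` Q -> mQ (ordered s).
Proof.
elim: s => [_|a s IHs] sQ; first exact: measurable_cst.
have sQ' : past s `<=` Q by exact: subset_trans (@past_cons a s) sQ.
apply: measurable_and; first exact: IHs.
apply: measurable_fun_ltr; first exact: measurable_clock.
exact: (@measurable_clock (a :: s)).
Qed.

Lemma measurable_ordered_natr s : past s `<=` Q ->
  mQ (fun w => (ordered s w)%:R : R).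
Proof.
move=> sQ; have -> : (fun w => (ordered s w)%:R : R) =
    (fun w => if ordered s w then 1 else 0).
  by apply/funext => w; case: ordered.
by apply: measurable_fun_ifT => //; exact: measurable_ordered.
Qed.

Lemma measurable_pending_ring b s : past s `<=` Q ->
  Q (b, count_mem b s) -> mQ (pending_ring b s).
Proof.
move=> sQ bQ.
have -> : pending_ring b s = ring_sum b s \+ xi (b, count_mem b s).
  by apply/funext => w; rewrite pending_ringE.
apply: measurable_funD; first exact: measurable_ring_sum.
exact: measurable_RV_cylType.
Qed.

Lemma measurable_prod_elapsed (q : pred {set V}) s :
  past s `<=` Q ->
  mQ (fun w => \prod_(b in edges e | q b) expR (- elapsed b s w)).
Proof.
move=> sQ; have -> : (fun w => \prod_(b in edges e | q b) expR (- elapsed b s w)) =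
    (fun w => \prod_(b <- [seq b <- enum (edges e) | q b]) expR (- elapsed b s w)).
  by apply/funext => w; rewrite big_filter big_enum_cond.
apply: measurable_prod => b _.
by apply: measurableT_comp => //; apply: measurable_funN; exact: measurable_elapsed.
Qed.

Lemma measurable_weight s : past s `<=` Q -> mQ (weight s).
Proof.
move=> sQ; have -> : weight s =
    (fun w => \prod_(b in edges e | xpredT b) expR (- elapsed b s w)).
  by apply/funext => w; apply: eq_bigl => b; rewrite andbT.
exact: measurable_prod_elapsed.
Qed.

End measurability.

Hypothesis clocks : alarm_clocks e xi.

Let indices : set ({set V} * nat) := [set i | i.1 \in edges e].

Let indep : mutually_independent indices xi := clocks.1.

Let exponential_xi b j : b \in edges e -> forall B : set R, measurable B ->
  distribution P (xi (b, j)) B = exponential_prob 1 B := @clocks.2 b j.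

Let past_fresh b s : all [in edges e] s ->
  past s `<=` indices `\ (b, count_mem b s).
Proof.
rewrite /past => sE [b' j] /= jlt; split => /=; last first.
  by move=> [bb jj]; move: jlt; rewrite bb jj ltnn.
by apply: (allP sE b'); rewrite -has_pred1 has_count; exact: leq_ltn_trans jlt.
Qed.

(** The pending clocks are integrated out one at a time: [integral_memoryless] with [r = 1] turns
    the indicator of the head of [l] into [expR (- elapsed b s w)], a function of the past that is
    absorbed into [F]. *)
Let integral_fresh_rings (l : seq {set V}) s (F : Om -> R) :
    uniq l -> all [in edges e] l -> all [in edges e] s ->
    (forall Q, past s `<=` Q -> measurable_fun (setT : set (cylType xi Q)) F) ->
    (forall w, 0 <= F w) -> (forall w, ~~ ordered s w -> F w = 0) ->
  (\int[P]_w (F w *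
      \prod_(b <- l) (if clock s w < pending_ring b s w then 1 else 0))%:E =
   \int[P]_w (F w * \prod_(b <- l) expR (- elapsed b s w))%:E)%E.
Proof.
elim: l F => [|b l IHl] F.
  by move=> *; apply: eq_integral => w _; rewrite !big_nil.
move=> /= /andP[bl ul] /andP[bE lE] sE mF F0 Fo.
pose G w := F w * \prod_(b <- l) (if clock s w < pending_ring b s w then 1 else 0).
have G0 w : 0 <= G w.
  by rewrite mulr_ge0// prodr_ge0// => i _; case: ifP.
have := @integral_memoryless _ _ _ _ _ indices xi indep (b, count_mem b s) G
  (elapsed b s) 1 bE (exponential_xi _ bE).
have mG : measurable_fun (setT : set (cylType xi (indices `\ (b, count_mem b s)))) G.
  apply: measurable_funM; first exact: (mF _ (past_fresh _ sE)).
  apply: measurable_prod => b' b'l; apply: measurable_fun_ifT => //.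
  apply: measurable_fun_ltr; first exact: (measurable_clock (past_fresh _ sE)).
  apply: measurable_pending_ring; [exact: (past_fresh _ sE)|split].
    exact: (allP lE).
  by move=> [bb' _]; move: bl; rewrite -bb' b'l.
move=> /(_ mG (measurable_elapsed _ (past_fresh _ sE)) G0 _ ltr01) H.
transitivity (\int[P]_w (G w * (if elapsed b s w < xi (b, count_mem b s) w
   then expR (- (1 - 1) * (xi (b, count_mem b s) w - elapsed b s w)) else 0))%:E)%E.
  apply: eq_integral => w _; congr (_%:E); rewrite big_cons clock_lt_pending subrr oppr0 mul0r expR0.
  by rewrite mulrCA mulrC.
rewrite H; last first.
  move=> w Gw; apply: elapsed_ge0; apply: contraNT Gw => /Fo Fw.
  by rewrite /G Fw mul0r.
transitivity (\int[P]_w (F w * expR (- elapsed b s w) *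
    \prod_(b <- l) (if clock s w < pending_ring b s w then 1 else 0))%:E)%E.
  by apply: eq_integral => w _; congr (_%:E); rewrite /G divr1 mulrAC.
rewrite IHl//.
- by apply: eq_integral => w _; congr (_%:E); rewrite big_cons mulrA.
- move=> Q sQ; apply: measurable_funM; first exact: mF.
  by apply: measurableT_comp => //; apply: measurable_funN; exact: measurable_elapsed.
- by move=> w; rewrite mulr_ge0// expR_ge0.
- by move=> w /Fo->; rewrite mul0r.
Qed.

Lemma integral_history s (F : Om -> R) : all [in edges e] s ->
    (forall Q, past s `<=` Q -> measurable_fun (setT : set (cylType xi Q)) F) ->
    (forall w, 0 <= F w) -> (forall w, ~~ ordered s w -> F w = 0) ->
  (\int[P]_w (F w * (history s w)%:R)%:E =
   \int[P]_w (F w * weight s w)%:E)%E.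
Proof.
move=> sE mF F0 Fo.
have := @integral_fresh_rings (enum (edges e)) s F (enum_uniq _) _ sE mF F0 Fo.
under [X in _ -> _ = X]eq_integral do rewrite /weight -big_enum.
move=> <-; last by apply/allP => b; rewrite mem_enum.
apply: eq_integral => w _; congr (_%:E).
have [os|/Fo->] := boolP (ordered s w); last by rewrite !mul0r.
congr (_ * _); rewrite /history os/= big_enum/=.
case: forall_inP => [H|/forall_inP].
  by rewrite big1// => b /H ->.
rewrite negb_forall_in => /exists_inP[b bE /negbTE Hb].
by rewrite (bigD1 b)//= Hb mul0r.
Qed.

Let K : R := #|edges e|%:R.

(** When [a] rings after a further delay [y], its own age returns to 0 and the [K - 1] other clocks
    age by [y], whence [expR (- (K - 1) * y)]. *)
Let weight_cons a s w : a \in edges e ->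
  (ordered (a :: s) w)%:R * weight (a :: s) w =
  ((ordered s w)%:R * \prod_(b in edges e | b != a) expR (- elapsed b s w)) *
  (if elapsed a s w < xi (a, count_mem a s) w
   then expR (- (K - 1) * (xi (a, count_mem a s) w - elapsed a s w)) else 0).
Proof.
move=> aE; rewrite [ordered _ _]/= clock_lt_pending.
case: (ordered s w); rewrite ?mul0r//=; case: ifP => _; rewrite ?mul0r ?mulr0// !mul1r.
rewrite /weight (bigD1 a)//= elapsed_cons eqxx oppr0 expR0 mul1r.
set y := _ - elapsed a s w.
transitivity (\prod_(b in edges e | b != a) (expR (- elapsed b s w) * expR (- y))).
  apply: eq_bigr => b /andP[_ ba]; rewrite elapsed_cons eq_sym (negbTE ba).
  by rewrite -expRD opprD.
rewrite big_split/=; congr (_ * _); rewrite prodr_const -expRM_natr.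
congr expR; rewrite mulrC mulNr mulrN; congr (- (_ * _)).
rewrite /K (cardsD1 a) aE natrD addrC addKr; congr _%:R.
by apply: eq_card => b; rewrite !inE andbC.
Qed.

(** Integrating out the waiting time of [a] yields [expR (- elapsed a s w) / r], whose numerator is
    the factor missing from [weight s]. The value [r = K] gives probabilities, [r = K / 2] bounds
    mean increments. *)
Let integral_weight_cons a s (r : R) : all [in edges e] s -> a \in edges e ->
  0 < r ->
  (\int[P]_w ((ordered s w)%:R * \prod_(b in edges e | b != a) expR (- elapsed b s w) *
   (if (elapsed a s w < xi (a, count_mem a s) w)%R
   then expR (- (r - 1) * (xi (a, count_mem a s) w - elapsed a s w)) else 0))%:E =
   r^-1%:E * \int[P]_w ((ordered s w)%:R * weight s w)%:E)%E.
Proof.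
move=> sE aE r0.
pose F w := (ordered s w)%:R * \prod_(b in edges e | b != a) expR (- elapsed b s w) : R.
have mF Q : past s `<=` Q -> measurable_fun (setT : set (cylType xi Q)) F.
  move=> sQ; apply: measurable_funM; first exact: measurable_ordered_natr.
  exact: measurable_prod_elapsed.
have F0 w : 0 <= F w by rewrite mulr_ge0// prodr_ge0// => i _; exact: expR_ge0.
have Fs w : F w != 0 -> 0 <= elapsed a s w.
  by move=> Fw; apply: elapsed_ge0; apply: contraNT Fw => /negbTE; rewrite /F => ->; rewrite mul0r.
rewrite (@integral_memoryless _ _ _ _ _ indices xi indep (a, count_mem a s) F
  (elapsed a s) r aE (exponential_xi _ aE) (mF _ (past_fresh _ sE))
  (measurable_elapsed _ (past_fresh _ sE)) F0 Fs r0).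
rewrite -ge0_integralZl//.
- apply: eq_integral => w _; rewrite -EFinM; congr (_%:E).
  by rewrite /F /weight [in RHS](bigD1 a)//=; ring.
- apply/measurable_EFinP; apply: (@measurable_fun_cylType _ _ _ _ _ xi (past s)).
  by apply: measurable_funM; [exact: measurable_ordered_natr|exact: measurable_weight].
- by move=> w _; rewrite lee_fin mulr_ge0// prodr_ge0// => i _; exact: expR_ge0.
- by rewrite lee_fin invr_ge0 ltW.
Qed.

(** Each ring contributes a factor [1 / K]: the edges that ring are uniform and independent. *)
Let integral_weight s : all [in edges e] s -> (0 < #|edges e|)%N ->
  (\int[P]_w ((ordered s w)%:R * weight s w)%:E = (K ^- size s)%:E)%E.
Proof.
move=> sE E0; have K0 : 0 < K by rewrite ltr0n.
elim: s sE => [_|a s IHs /= /andP[aE sE]].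
  rewrite (eq_integral (cst 1%E)) => [|w _].
    by rewrite integral_cst//= mul1e probability_setT expr0 invr1.
  rewrite mul1r /weight big1// => b _.
  by rewrite /elapsed /ring_sum big_ord0 subrr oppr0 expR0.
under eq_integral do rewrite weight_cons//.
by rewrite integral_weight_cons// IHs// -EFinM exprS invfM.
Qed.

Lemma measurable_history s : measurable [set w | history s w].
Proof.
pose Q : set ({set V} * nat) := setT.
have m (f : Om -> bool) : measurable_fun (setT : set (cylType xi Q)) f ->
    measurable [set w | f w].
  move=> mf; rewrite -[X in measurable X]setTI.
  by have /(_ measurableT [set true]) := measurable_fun_cylType mf; exact.
rewrite (_ : [set w | _] = [set w | ordered s w] `&`
    \bigcap_(b in [set` edges e]) [set w | clock s w < pending_ring b s w]).
  apply: measurableI; first by apply: m; exact: measurable_ordered.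
  apply: fin_bigcap_measurable; first exact: finite_finset.
  move=> b bE; apply: m; apply: measurable_fun_ltr; first exact: measurable_clock.
  exact: measurable_pending_ring.
apply/seteqP; split=> w /=; first by move=> /andP[os /forall_inP H]; split.
by move=> [os H]; rewrite /history os; apply/forall_inP.
Qed.

Lemma probability_history s : all [in edges e] s -> (0 < #|edges e|)%N ->
  P [set w | history s w] = (K ^- size s)%:E.
Proof.
move=> sE E0; have K0 : 0 < K by rewrite ltr0n.
transitivity (\int[P]_w ((ordered s w)%:R * (history s w)%:R)%:E)%E.
  rewrite -[X in P X]setIT -integral_indic//; last exact: measurable_history.
  apply: eq_integral => w _; congr (_%:E); rewrite indicE.
  have -> : (w \in [set w | history s w]) = history s w.
    by apply/idP/idP; rewrite in_setE.
  by rewrite /history; case: (ordered s w); rewrite /= ?mul1r ?mul0r.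
rewrite integral_history//; last 2 first.
- by move=> Q sQ; exact: measurable_ordered_natr.
- by move=> w /negbTE ->.
exact: integral_weight.
Qed.

Lemma clock_increment_ge0 a s w : ordered (a :: s) w ->
  0 <= clock (a :: s) w - clock s w.
Proof. by move=> /andP[_ /ltW]; rewrite subr_ge0. Qed.

(* The increment [y] is bounded by [(2 / K) * expR (K * y / 2)], which reduces the
   mean to [integral_memoryless] with [r = K / 2] and costs only a constant. *)
Lemma integral_clock_increment a s : all [in edges e] s -> a \in edges e ->
  (\int[P]_w ((clock (a :: s) w - clock s w) * (history (a :: s) w)%:R)%:E <=
   (4 / K ^+ 2 * K ^- size s)%:E)%E.
Proof.
move=> sE aE; have E0 : (0 < #|edges e|)%N by rewrite (cardsD1 a) aE.
have K0 : 0 < K by rewrite ltr0n.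
pose D w := clock (a :: s) w - clock s w.
have asE : all [in edges e] (a :: s) by rewrite /= aE.
have mD Q : past (a :: s) `<=` Q -> measurable_fun (setT : set (cylType xi Q)) D.
  move=> sQ; apply: measurable_funB; first exact: measurable_clock.
  by apply: measurable_clock => //; exact: subset_trans (@past_cons a s) sQ.
(* The factor [ordered], implied by [history], makes the integrand nonnegative and zero off ordered
   sequences, as [integral_history] requires. *)
apply: (@le_trans _ _
  (\int[P]_w (D w * (ordered (a :: s) w)%:R * (history (a :: s) w)%:R)%:E)%E).
  rewrite le_eqVlt; apply/orP; left; apply/eqP.
  apply: eq_integral => w _; congr (_%:E); rewrite -mulrA; congr (_ * _).
  by rewrite /history; case: (ordered (a :: s) w); rewrite /= ?mul1r ?mul0r.
have D0 w : 0 <= D w * (ordered (a :: s) w)%:R.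
  by case: (boolP (ordered (a :: s) w)) => [/clock_increment_ge0|_]; rewrite ?mulr1 ?mulr0.
have mDo Q : past (a :: s) `<=` Q ->
    measurable_fun (setT : set (cylType xi Q)) (fun w => D w * (ordered (a :: s) w)%:R).
  move=> sQ; apply: measurable_funM; first exact: mD.
  exact: measurable_ordered_natr.
rewrite (integral_history asE mDo D0); last by move=> w /negbTE ->; rewrite mulr0.
have mint f : measurable_fun (setT : set (cylType xi setT)) f ->
  measurable_fun (setT : set Om) (fun w => (f w)%:E : \bar R).
  by move=> mf; apply/measurable_EFinP; exact: measurable_fun_cylType mf.
pose F w := (ordered s w)%:R * \prod_(b in edges e | b != a) expR (- elapsed b s w) : R.
pose y w := xi (a, count_mem a s) w - elapsed a s w.
have F0 w : 0 <= F w by rewrite mulr_ge0// prodr_ge0// => i _; exact: expR_ge0.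
have sT Q' : Q' `<=` (setT : set ({set V} * nat)) by [].
have mF : measurable_fun (setT : set (cylType xi setT)) F.
  apply: measurable_funM; first exact: measurable_ordered_natr.
  exact: measurable_prod_elapsed.
have my : measurable_fun (setT : set (cylType xi setT)) y.
  apply: measurable_funB; first exact: measurable_RV_cylType.
  exact: measurable_elapsed.
have mI : measurable_fun (setT : set (cylType xi setT)) (fun w => F w *
   (if (elapsed a s w < xi (a, count_mem a s) w)
   then expR (- (K / 2 - 1) * y w) else 0)).
  apply: measurable_funM => //; apply: measurable_fun_ifT => //.
    apply: measurable_fun_ltr; first exact: measurable_elapsed.
    exact: measurable_RV_cylType.
  by apply: measurableT_comp => //; exact: measurable_funM.
apply: (@le_trans _ _ (\int[P]_w ((2 / K)%:E * (F w *
   (if (elapsed a s w < xi (a, count_mem a s) w)%R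
   then expR (- (K / 2 - 1) * y w) else 0))%:E))%E); last first.
  rewrite ge0_integralZl//.
  - rewrite integral_weight_cons ?divr_gt0//.
    rewrite integral_weight// -!EFinM lee_fin mulrA.
    by rewrite le_eqVlt; apply/orP; left; apply/eqP; congr (_ * _); field; exact: lt0r_neq0.
  - exact: mint.
  - by move=> w _; rewrite lee_fin mulr_ge0//; case: ifP => // _; exact: expR_ge0.
  - by rewrite lee_fin divr_ge0// ltW.
apply: ge0_le_integral => //.
- move=> w _; rewrite lee_fin mulr_ge0//; apply: prodr_ge0 => b _; exact: expR_ge0.
- apply: mint; apply: measurable_funM; first exact: mDo.
  exact: measurable_weight.
- by apply: emeasurable_funM => //; exact: mint.
move=> w _; rewrite -EFinM lee_fin -mulrA weight_cons// -/(F w) -/(y w).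
case: ifP => [lt_w|_]; last by rewrite !mulr0.
have -> : D w = y w by rewrite /D /y /elapsed /= pending_ringE; ring.
(* The first exponent is the one in [weight_cons]; the exponential of the second exceeds
   [K / 2 * y w]. *)
have -> : - (K / 2 - 1) * y w = - (K - 1) * y w + K / 2 * y w by field.
rewrite expRD mulrCA [leRHS]mulrCA ler_wpM2l//.
rewrite [leRHS]mulrCA mulrC ler_wpM2l ?expR_ge0//.
rewrite -ler_pdivrMl ?divr_gt0//.
have := expR_ge1Dx (K / 2 * y w); lra.
Qed.

End histories.

(** * The chain driven by uniformly chosen edges *)

Section jump_chain.
Context {R : realType} {V : finType} (e : rel V).
Hypothesis irr_e : irreflexive e.
Implicit Types (a b : {set V}) (x y u v : V) (s : seq {set V}).

Definition move a x : V := odflt x [pick y | e x y && (a == [set x; y]%SET)].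

Definition position v s : V := foldr move v s.

Fixpoint avoids u v s : bool :=
  if s is a :: s' then avoids u v s' && (position v s != u) else v != u.

Fixpoint words n : seq (seq {set V}) :=
  if n is n'.+1 then [seq a :: s | a <- enum (edges e), s <- words n']
  else [:: [::]].

Local Notation K := (#|edges e|%:R : R).

(** One-step operator of the lazy chain that picks a uniform edge and crosses it if incident, killed
    at [u]. *)
Definition killed_mean u (g : V -> R) x : R :=
  if x == u then 0 else K^-1 * \sum_(a in edges e) g (move a x).

(** Probability that this chain avoids [u] at times 0 to [m], as a function of the starting vertex;
    see [sum_words_survival]. *)
Definition survival u m : V -> R :=
  iter m (killed_mean u) (fun x => (x != u)%:R).

Lemma edge_in x y : e x y -> [set x; y]%SET \in edges e.
Proof. by move=> exy; apply/imsetP; exists (x, y). Qed.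

Lemma edge_inj x y y' : e x y -> e x y' -> [set x; y]%SET = [set x; y']%SET -> y = y'.
Proof.
move=> exy exy' E; have : y \in [set x; y']%SET by rewrite -E !inE eqxx orbT.
by rewrite !inE => /predU1P[yx|/eqP//]; move: exy; rewrite yx irr_e.
Qed.

Lemma move_edge x y : e x y -> move [set x; y]%SET x = y.
Proof.
move=> exy; rewrite /move; case: pickP => [z /andP[exz /eqP E]|/(_ y)] /=.
  exact/esym/(edge_inj exy exz).
by rewrite exy eqxx.
Qed.

Lemma move_fix a x : (forall y, e x y -> a != [set x; y]%SET) -> move a x = x.
Proof.
move=> H; rewrite /move; case: pickP => //= y /andP[/H/negP ay /eqP ea].
by case: ay; apply/eqP.
Qed.

Lemma avoids_position u v s : avoids u v s -> position v s != u.
Proof. by case: s => [|a s] //= /andP[]. Qed.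

Lemma mem_words n s : s \in words n -> size s = n /\ all [in edges e] s.
Proof.
elim: n s => [|n IHn] s /=; first by rewrite inE => /eqP->.
move=> /allpairsP[[a t] /= []]; rewrite mem_enum => aE /IHn[<- tE] ->.
by split => //=; rewrite aE.
Qed.

Lemma uniq_words n : uniq (words n).
Proof.
elim: n => //= n IHn; apply: allpairs_uniq => //; first exact: enum_uniq.
by move=> [a s] [a' s'] _ _ /= [-> ->].
Qed.

Lemma size_words n : size (words n) = (#|edges e| ^ n)%N.
Proof. by elim: n => //= n IHn; rewrite size_allpairs IHn -cardE expnS. Qed.

Lemma big_words_cons n (F : seq {set V} -> R) :
  \sum_(s <- words n.+1) F s =
  \sum_(s <- words n) \sum_(a in edges e) F (a :: s).
Proof. by rewrite /= big_allpairs_dep exchange_big/=; under eq_bigr do rewrite big_enum. Qed.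

Lemma sum_words_avoids u v n (g : V -> R) : g u = 0 ->
  \sum_(s <- words n) (avoids u v s)%:R * g (position v s) * K ^- n =
  iter n (killed_mean u) g v.
Proof.
elim: n g => [|n IHn] g gu.
  rewrite /= big_seq1 /= expr0 invr1 mulr1.
  by have [->|] := eqVneq v u; rewrite ?gu ?mul0r ?mul1r.
rewrite big_words_cons iterSr -IHn; last by rewrite /killed_mean eqxx.
apply: eq_bigr => s _; have [av|nav] := boolP (avoids u v s); last first.
  by rewrite !mul0r big1// => a _; rewrite /= (negbTE nav) !mul0r.
rewrite /killed_mean (negbTE (avoids_position av)) mul1r [K^-1 * _]mulrC.
rewrite -[RHS]mulrA mulr_suml; apply: eq_bigr => a aE.
rewrite /= av exprS invfM; congr (_ * _).
by case: eqP => [->|_]; rewrite ?gu ?mulr0 ?mul1r.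
Qed.

Lemma sum_words_survival u v n :
  \sum_(s <- words n | avoids u v s) K ^- n = survival u n v.
Proof.
rewrite /survival -sum_words_avoids; last by rewrite eqxx.
rewrite big_mkcond; apply: eq_bigr => s _.
by case: ifP => av; rewrite ?mul0r// avoids_position// !mul1r.
Qed.

Lemma survival_ge0 u n v : 0 <= survival u n v.
Proof.
rewrite -sum_words_survival; apply: sumr_ge0 => s _.
by rewrite invr_ge0 exprn_ge0.
Qed.

Lemma survival_root u n : survival u n u = 0.
Proof. by case: n => [|n]; rewrite /survival /= ?eqxx// /killed_mean eqxx. Qed.

End jump_chain.

(** * The walk read off from a history *)

Section realization.
Context {R : realType} {V : finType} (e : rel V).
Hypothesis irr_e : irreflexive e.
Context {disp : measure_display} {Om : measurableType disp}.
Context {P : probability Om R} (xi : {set V} * nat -> {RV P >-> R}).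
Implicit Types (a b : {set V}) (x y u v : V) (s : seq {set V}) (w : Om).

Definition nonneg_clocks w := forall b j, b \in edges e -> 0 <= xi (b, j) w.

Lemma le_ring_time w b i j : nonneg_clocks w -> b \in edges e -> (i <= j)%N ->
  ring_time xi b i w <= ring_time xi b j w.
Proof.
move=> w0 bE ij; rewrite /ring_time -!(big_mkord xpredT (fun i => xi (b, i) w)).
rewrite [leRHS](big_cat_nat (n := i.+1))//= lerDl; apply: sumr_ge0 => k _; exact: w0.
Qed.

(** Rings of [b] with a smaller index occur no later than [ring_sum b s w], hence not after
    [clock s]. *)
Lemma next_ring_clock w b s : nonneg_clocks w -> b \in edges e ->
  history e xi s w ->
  next_ring xi b (clock xi s w)%:E w = (pending_ring xi b s w)%:E.
Proof.
move=> w0 bE /andP[os /forall_inP lt_s]; apply/eqP; rewrite eq_le; apply/andP; split.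
  apply: ereal_inf_lbound; exists (count_mem b s) => //=.
  by rewrite lte_fin; exact: lt_s.
apply: le_ereal_inf_tmp => _ [j /= + <-]; rewrite lte_fin lee_fin => lt_j.
apply: le_ring_time => //; rewrite leqNgt; apply/negP => jb.
move: lt_j; rewrite ltNge => /negP; apply.
apply: le_trans (ring_sum_le_clock b os).
rewrite /ring_sum -(prednK (leq_ltn_trans (leq0n _) jb)).
by apply: (@le_ring_time w b j (count_mem b s).-1) => //; rewrite -ltnS prednK// (leq_ltn_trans _ jb).
Qed.

(** The last arrival time [t] may precede [clock s], since rings away from the walker do not move
    it. The invariant says that the edges at its position have not rung in between, so their next
    ring after [t] is the pending one. *)
Lemma walk_history v w s : nonneg_clocks w -> all [in edges e] s ->
  history e xi s w ->
  exists m, exists t, [/\ walk e xi v w m = (position e v s, t%:E),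
    t <= clock xi s w &
    forall y, e (position e v s) y ->
      next_ring xi [set position e v s; y]%SET t%:E w =
      (pending_ring xi [set position e v s; y]%SET s w)%:E].
Proof.
move=> w0; elim: s => [_ h|a s IHs /= /andP[aE sE] h].
  exists 0%N, 0; split => // y exy.
  by apply: (next_ring_clock w0 (edge_in exy) h).
have hs := history_tail aE h.
have [m [t [wm ts tnext]]] := IHs sE hs.
set x := position e v s in wm tnext *.
have lt_a b : b \in edges e -> b != a ->
    pending_ring xi a s w < pending_ring xi b s w.
  move=> bE ba; move: h => /andP[_ /forall_inP/(_ _ bE)].
  by rewrite pending_ring_cons// eq_sym.
(* If [a] is incident to [x], its ring is the earliest at [x] and the walk makes one more jump;
   otherwise [m] and [t] are kept. *)
have [/existsP[y /andP[exy /eqP ay]]|nex] := boolP [exists y, e x y && (a == [set x; y]%SET)].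
  exists m.+1, (clock xi (a :: s) w).
  have jumpE : next_jump e xi x t%:E w = (pending_ring xi a s w)%:E.
    apply/eqP; rewrite eq_le; apply/andP; split.
      by rewrite /next_jump; apply: (bigmin_inf y) => //; rewrite tnext// -ay.
    rewrite /next_jump; apply: le_bigmin => [|z exz]; first exact: leey.
    rewrite tnext// lee_fin; have [->//|za] := eqVneq [set x; z]%SET a.
    exact/ltW/lt_a/za/edge_in.
  have mx : move e a x = y by rewrite ay move_edge.
  split => //.
  - rewrite /walk iterS -/(walk e xi v w m) wm /walk_step/= jumpE mx; congr (_, _).
    case: pickP => [z /andP[exz]|/(_ y)]; last by rewrite exy tnext// -ay eqxx.
    rewrite tnext// => /eqP[] ez /=; apply: (edge_inj irr_e exz exy).
    rewrite -ay; apply/eqP/negPn/negP => za.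
    by have := lt_a _ (edge_in exz) za; rewrite ez ltxx.
  - by move=> z ez; apply: next_ring_clock => //; exact: edge_in.
have fixx : move e a x = x.
  apply: move_fix => y exy; apply/negP => /eqP ay; move/negP: nex; apply.
  by apply/existsP; exists y; rewrite exy ay eqxx.
exists m, t; rewrite -/x fixx; split => //.
  by move: h => /andP[/andP[_ /ltW le_s] _]; exact: le_trans le_s.
move=> y exy; rewrite tnext// pending_ring_cons//.
apply/negP => /eqP ay; move/negP: nex; apply.
by apply/existsP; exists y; rewrite exy ay eqxx.
Qed.

Lemma hitting_time_le_clock u v w s : nonneg_clocks w -> all [in edges e] s ->
  history e xi s w -> position e v s = u ->
  (hitting_time e xi v u w <= (clock xi s w)%:E)%E.
Proof.
move=> w0 sE h su; have [m [t [wm ts _]]] := walk_history v w0 sE h.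
apply: ge_ereal_inf; exists t%:E; last by rewrite lee_fin.
by exists m; rewrite /= wm.
Qed.

(** At most one history of each length occurs, so at most one term is nonzero: the waiting time
    before ring [m + 1], if [u] has been avoided so far. *)
Definition increments u v m w : R :=
  \sum_(s <- words e m | avoids e u v s) \sum_(a in edges e)
    (clock xi (a :: s) w - clock xi s w) * (history e xi (a :: s) w)%:R.

Lemma clock_increment_natr_ge0 a s w :
  0 <= (clock xi (a :: s) w - clock xi s w) * (history e xi (a :: s) w)%:R.
Proof.
have [/andP[/clock_increment_ge0 H _]|] := boolP (history _ _ _ _).
  by rewrite mulr1.
by rewrite mulr0.
Qed.

Lemma increments_ge0 u v m w : 0 <= increments u v m w.
Proof.
by apply: sumr_ge0 => s _; apply: sumr_ge0 => a _; exact: clock_increment_natr_ge0.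
Qed.

(** Until [u] is visited the sum dominates the clock; at the first visit this bound passes to the
    hitting time, and later terms are nonnegative. *)
Lemma hitting_time_le_increments u v w n s : nonneg_clocks w ->
  s \in words e n -> history e xi s w ->
  (avoids e u v s /\ clock xi s w <= \sum_(m < n) increments u v m w) \/
  (hitting_time e xi v u w <= (\sum_(m < n) increments u v m w)%:E)%E.
Proof.
move=> w0; elim: n s => [|n IHn] s.
  rewrite inE => /eqP -> h; rewrite big_ord0 /=.
  have [vu|] := eqVneq v u; last by left.
  by right; exact: (@hitting_time_le_clock u v w [::]).
move=> /allpairsP[[a t] /= [aE tn ->]]; rewrite mem_enum in aE.
move=> h; have [_ tE] := mem_words tn; have ht := history_tail aE h.
have [[av le_t]|H] := IHn _ tn ht; last first.
  right; apply: (le_trans H); rewrite lee_fin big_ord_recr lerDl.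
  exact: increments_ge0.
have le_at : clock xi (a :: t) w <= \sum_(m < n.+1) increments u v m w.
  rewrite big_ord_recr -[leLHS](subrK (clock xi t w)) addrC.
  apply: lerD; first exact: le_t.
  (* Only the term of the history [a :: t] that occurred is kept. *)
  rewrite /increments (big_rem t)//= av.
  rewrite (bigD1 a)//= h mulr1 -addrA lerDl addr_ge0//.
    by apply: sumr_ge0 => b _; exact: clock_increment_natr_ge0.
  apply: sumr_ge0 => r _; apply: sumr_ge0 => b _; exact: clock_increment_natr_ge0.
have [pu|pu] := eqVneq (position e v (a :: t)) u.
  right; apply: (@le_trans _ _ (clock xi (a :: t) w)%:E); last by rewrite lee_fin.
  by apply: hitting_time_le_clock => //=; rewrite aE.
by left; rewrite /= av pu.
Qed.

End realization.

(** Read off the definition of the integral as a supremum over simple functions, so that it applies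
    to [hitting_time] without a proof of its measurability. *)
Lemma le_ge0_integral d (T : measurableType d) (R : realType)
    (mu : {measure set T -> \bar R}) (f g : T -> \bar R) :
    (forall x, f x <= g x)%E -> (forall x, 0 <= g x)%E ->
  (\int[mu]_x f x <= \int[mu]_x g x)%E.
Proof.
move=> fg g0; rewrite integralE; apply: (@le_trans _ _ (\int[mu]_x f^\+ x)%E).
  rewrite -[leRHS]sube0 leeB//; exact: integral_ge0.
rewrite [leLHS]ge0_integralTE// [leRHS]ge0_integralTE//; apply: ereal_sup_le.
move=> _ [h /= hf <-]; exists h => //= x; apply: (le_trans (hf x)).
by rewrite funeposE ge_max fg g0.
Qed.

(** * Mean hitting times bounded by sums of survival probabilities *)

Section mean_hitting_time.
Context {R : realType} {V : finType} (e : rel V).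
Hypothesis irr_e : irreflexive e.
Context {disp : measure_display} {Om : measurableType disp}.
Context {P : probability Om R} (xi : {set V} * nat -> {RV P >-> R}).
Hypothesis clocks : alarm_clocks e xi.
Hypothesis edges_gt0 : (0 < #|edges e|)%N.
Variables (u v : V).

Local Notation K := (#|edges e|%:R : R).

Let K_gt0 : 0 < K. Proof. by rewrite ltr0n. Qed.

Let measurable_increment s a : measurable_fun (setT : set Om)
  (fun w => ((clock xi (a :: s) w - clock xi s w) *
    (history e xi (a :: s) w)%:R)%:E : \bar R).
Proof.
have mc t : measurable_fun (setT : set Om) (clock xi t).
  by apply: (@measurable_fun_cylType _ _ _ _ _ xi setT); exact: measurable_clock.
apply/measurable_EFinP/measurable_funM; first exact: measurable_funB.
rewrite (_ : (fun w => _) = \1_[set w | history e xi (a :: s) w] :> (Om -> R)).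
  by apply: measurable_indic; exact: measurable_history.
apply/funext => w; rewrite indicE; congr ((nat_of_bool _)%:R).
by apply/idP/idP; rewrite in_setE.
Qed.

Let EFin_increments m w : (increments e xi u v m w)%:E =
  (\sum_(s <- [seq s <- words e m | avoids e u v s]) \sum_(a <- enum (edges e))
     ((clock xi (a :: s) w - clock xi s w) * (history e xi (a :: s) w)%:R)%:E)%E.
Proof.
rewrite /increments -big_filter -sumEFin; apply: eq_bigr => s _.
by rewrite -sumEFin big_enum.
Qed.

Let measurable_increments m :
  measurable_fun (setT : set Om) (fun w => (increments e xi u v m w)%:E : \bar R).
Proof.
under eq_fun do rewrite EFin_increments.
by apply: emeasurable_sum => t; exact: emeasurable_sum.
Qed.

(** Each avoiding word has [K] extensions, each contributing at most [4 / K ^+ 2 * K ^- m]. *)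
Let integral_increments m :
  (\int[P]_w (increments e xi u v m w)%:E <= (4 / K * survival e u m v)%:E)%E.
Proof.
under eq_integral do rewrite EFin_increments.
rewrite ge0_integral_sum//; last 2 first.
- by move=> s; exact: emeasurable_sum.
- move=> s w _; apply: sume_ge0 => a _; rewrite lee_fin.
  exact: clock_increment_natr_ge0.
rewrite -sum_words_survival mulr_sumr -[in leRHS]big_filter -sumEFin big_seq [leRHS]big_seq.
apply: lee_sum => s; rewrite mem_filter => /andP[_ /mem_words[sm sE]].
rewrite ge0_integral_sum//; last first.
  by move=> a w _; rewrite lee_fin; exact: clock_increment_natr_ge0.
apply: (@le_trans _ _ (\sum_(a <- enum (edges e)) (4 / K ^+ 2 * K ^- m)%:E)%E).
  rewrite big_seq [leRHS]big_seq; apply: lee_sum => a; rewrite mem_enum => aE.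
  by rewrite -sm; exact: integral_clock_increment.
rewrite sumEFin lee_fin big_enum/= sumr_const -[leLHS]mulr_natr.
rewrite le_eqVlt; apply/orP; left; apply/eqP; set T := K ^- m.
by field; exact: lt0r_neq0.
Qed.

Let negative_clocks_negligible : P.-negligible [set w | ~ nonneg_clocks e xi w].
Proof.
pose F (n : nat) : set Om :=
  if unpickle n is Some (b, j) then
    if b \in edges e then xi (b, j) @^-1` [set` `]-oo, 0[%R] else set0
  else set0.
apply: (@negligibleS _ _ _ _ (\bigcup_n F n)).
  move=> w /= /existsNP[b /existsNP[j /not_implyP[bE /negP]]]; rewrite -ltNge => lt0.
  by exists (pickle (b, j)) => //; rewrite /F pickleK bE /= in_itv.
apply: negligible_bigcup => n; rewrite /F.
case: (unpickle n) => [[b j]|]; last exact: negligible_set0.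
case: ifP => bE; last exact: negligible_set0.
apply/negligibleP.
  by rewrite -[X in measurable X]setTI; exact: measurable_funP.
rewrite -[LHS]/(distribution P (xi (b, j)) _) clocks.2//.
apply: integral0_eq => x; rewrite /= in_itv/= => x0.
by rewrite lt0_exponential_pdf.
Qed.

(** For every [m] the event excludes all histories of length [m] that visit [u]. These are disjoint,
    of total probability [1 - survival e u m v], so the event lies in sets of arbitrarily small
    probability. *)
Let never_hit_negligible : (forall C : R, 0 < C -> exists m, survival e u m v <= C) ->
  P.-negligible [set w | forall m s, s \in words e m -> ~~ avoids e u v s ->
    ~~ history e xi s w].
Proof.
move=> small; pose W m := [seq s <- words e m | ~~ avoids e u v s].
pose U m : set Om := \bigcup_(s in [set` W m]) [set w | history e xi s w].
have mU m : measurable (U m).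
  by apply: fin_bigcup_measurable => [|s _]; [exact: finite_seq|exact: measurable_history].
have PU m : P (~` U m) = (survival e u m v)%:E.
  rewrite probability_setC// measure_fin_bigcup//; last 3 first.
  - exact: finite_seq.
  - move=> s s' /=; rewrite /W !mem_filter => /andP[_ /mem_words[ss sE]].
    move=> /andP[_ /mem_words[ss' sE']] [w [/= h h']].
    by apply: (history_inj _ sE sE' h h'); rewrite ss.
  - by move=> s _; exact: measurable_history.
  rewrite -fsbig_seq ?filter_uniq ?uniq_words//= big_seq.
  under eq_bigr.
    move=> s; rewrite /W mem_filter => /andP[_ /mem_words[ss sE]].
    rewrite probability_history// ss; over.
  rewrite -big_seq sumEFin -EFinB -(sum_words_survival e u v m) big_filter.
  congr (_%:E); apply/eqP; rewrite subr_eq.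
  have E : \sum_(s <- words e m) K ^- m = 1 :> R.
    rewrite big_const_seq count_predT size_words iter_addr_0.
    by rewrite -(mulr_natl (K ^- m)) natrX mulfV// expf_neq0// lt0r_neq0.
  by rewrite (bigID (avoids e u v))/= in E; rewrite E.
exists (\bigcap_m ~` U m); split.
- by apply: bigcapT_measurable => m; exact: measurableC.
- apply/eqP; rewrite eq_le measure_ge0 andbT; apply/lee_addgt0Pr => c c0.
  rewrite add0e; have [m le_c] := small c c0.
  apply: (@le_trans _ _ (survival e u m v)%:E); last by rewrite lee_fin.
  rewrite -PU; apply: le_measure; rewrite ?inE//.
  - by apply: bigcapT_measurable => k; exact: measurableC.
  - exact: measurableC.
  - by move=> w; apply.
- move=> w /= H m _ [s /=]; rewrite /W mem_filter => /andP[nav sm].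
  exact/negP/(H m s sm nav).
Qed.

Lemma mean_hitting_time_le (C : R) :
  (forall M, \sum_(m < M) survival e u m v <= C * K) ->
  (mean_hitting_time e xi v u <= (4 * C)%:E)%E.
Proof.
move=> HC.
(* Otherwise all survival probabilities exceed [c], and more than [C * K / c] of them sum to more
   than [C * K]. *)
have small (c : R) : 0 < c -> exists m, survival e u m v <= c.
  move=> c0; apply: contrapT => /forallNP big_s.
  have [M HM] : exists M : nat, C * K < c * M%:R.
    exists (Num.trunc (`|C * K / c|)).+1.
    rewrite -ltr_pdivrMl// mulrC (le_lt_trans (ler_norm _))//.
    by rewrite truncnS_gt.
  have := HC M; rewrite leNgt => /negP; apply; apply: (lt_le_trans HM).
  rewrite mulr_natr -[X in _ *+ X]card_ord -sumr_const; apply: ler_sum => i _.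
  by apply/ltW; rewrite ltNge; apply/negP; exact: big_s.
have [N [mN N0 subN]] : P.-negligible ([set w | ~ nonneg_clocks e xi w] `|`
  [set w | forall m s, s \in words e m -> ~~ avoids e u v s -> ~~ history e xi s w]).
  exact: negligibleU negative_clocks_negligible (never_hit_negligible small).
pose g w := (\sum_(m <oo) (increments e xi u v m w)%:E)%E.
have g0 w : (0 <= g w)%E.
  by apply: nneseries_ge0 => m _ _; rewrite lee_fin increments_ge0.
(* The infinite value on the null set [N] makes the bound hold everywhere and integrates to 0. *)
have le_g w : (hitting_time e xi v u w <= g w + +oo * (\1_N w)%:E)%E.
  have [wN|wN] := pselect (N w).
    by rewrite indicE mem_set// mule1 addey// ?leey// gt_eqF// (lt_le_trans _ (g0 w)).
  rewrite indicE memNset// mule0 adde0.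
  have w0 : nonneg_clocks e xi w by apply: contrapT => nw; apply: wN; apply: subN; left.
  have /existsNP[m /existsNP[s]] : ~ (forall m s, s \in words e m ->
      ~~ avoids e u v s -> ~~ history e xi s w).
    by move=> H; apply: wN; apply: subN; right.
  move=> /not_implyP[sm /not_implyP[nav /negP/negPn h]].
  have [[av]|H] := hitting_time_le_increments irr_e u v w0 sm h.
    by rewrite av in nav.
  apply: (le_trans H); rewrite -sumEFin -(big_mkord xpredT (fun m => (increments e xi u v m w)%:E)).
  by apply: nneseries_lim_ge => k _ _; rewrite lee_fin increments_ge0.
rewrite /mean_hitting_time.
have N_ge0 w : (0 <= +oo * (\1_N w)%:E :> \bar R)%E by rewrite mule_ge0// lee_fin.
apply: (@le_trans _ _ (\int[P]_w (g w + +oo * (\1_N w)%:E))%E).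
  by apply: le_ge0_integral => // w; rewrite adde_ge0.
have m1 : measurable_fun (setT : set Om) (fun w => (\1_N w)%:E : \bar R).
  by apply/measurable_EFinP; exact: measurable_indic.
have mg : measurable_fun setT g.
  by apply: ge0_emeasurable_sum => // m w _ _; rewrite lee_fin increments_ge0.
rewrite ge0_integralD//; last exact: measurable_funeM.
rewrite ge0_integralZl// integral_indic// setIT [X in (+oo * X)%E]N0 mule0 adde0.
rewrite integral_nneseries//; last by move=> m w _; rewrite lee_fin increments_ge0.
apply: lime_le.
  by apply: is_cvg_nneseries => m _ _; apply: integral_ge0 => w _; rewrite lee_fin increments_ge0.
apply: nearW => M; apply: (@le_trans _ _ (\sum_(0 <= m < M) (4 / K * survival e u m v)%:E)%E).
  by apply: lee_sum => m _; exact: integral_increments.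
rewrite sumEFin lee_fin -mulr_sumr big_mkord.
by rewrite -mulrA ler_wpM2l// mulrC ler_pdivrMr.
Qed.

End mean_hitting_time.

(** * The truncated Green function of the killed chain *)

Section green_function.
Context {R : realType} {V : finType} (e : rel V).
Hypothesis irr_e : irreflexive e.
Implicit Types (x y u : V).

Local Notation K := (#|edges e|%:R : R).

(** Edges not incident to [x] contribute 0, the others correspond to the neighbours of [x]. *)
Lemma sum_edges_move (f : V -> R) x :
  \sum_(a in edges e) (f x - f (move e a x)) = \sum_(y | e x y) (f x - f y).
Proof.
pose star := [set [set x; y]%SET | y in [pred y | e x y]]%SET.
have sub : star \subset edges e.
  by apply/fintype.subsetP => _ /imsetP[y exy ->]; exact: edge_in.
rewrite (big_setID star)/= (finset.setIidPr sub) [X in _ + X]big1 ?addr0.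
  rewrite big_imset/=; last by move=> y z exy exz; exact: (edge_inj irr_e).
  by apply: eq_bigr => y exy; rewrite move_edge.
move=> a; rewrite inE => /andP[aN _]; rewrite move_fix ?subrr// => y exy.
by apply: contraNneq aN => ->; apply/imsetP; exists y.
Qed.

Definition green u M x : R := \sum_(m < M) survival e u m x / K.

Lemma green_root u M : green u M u = 0.
Proof. by rewrite /green big1// => m _; rewrite survival_root mul0r. Qed.

(** Away from [u], averaging over edges shifts [survival u m] to [survival u m.+1], so the total
    drop telescopes to [survival e u 0 x - survival e u M x], at most 1. *)
Lemma green_drift u M x : (0 < #|edges e|)%N -> x != u ->
  \sum_(y | e x y) (green u M x - green u M y) <= 1.
Proof.
move=> E0 xu; have K0 : K != 0 by rewrite pnatr_eq0 -lt0n.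
rewrite -sum_edges_move sumrB sumr_const -[_ *+ _]mulr_natl.
have -> : \sum_(a in edges e) green u M (move e a x) =
    \sum_(m < M) survival e u m.+1 x.
  rewrite exchange_big/=; apply: eq_bigr => m _.
  by rewrite /survival/= /killed_mean (negbTE xu) -mulr_suml mulrC.
rewrite /green mulr_sumr.
under eq_bigr do rewrite mulrC divfK//.
rewrite -sumrB -(big_mkord xpredT (fun m => survival e u m x - survival e u m.+1 x)).
under eq_bigr do rewrite -opprB.
rewrite sumrN telescope_sumr// opprB lerBlDr /survival/= xu lerDl.
exact: survival_ge0.
Qed.

End green_function.

(** * Flow out of the level sets of a function with bounded drift *)

Section level_sets.
Context {R : realType} {V : finType} (e : rel V) (f : V -> R) (u : V) (d : nat).
Hypothesis sym_e : symmetric e.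
Hypothesis degree_le : forall x, (degree e x <= d)%N.
Hypothesis fu : f u = 0.
Hypothesis drift : forall x, x != u -> \sum_(y | e x y) (f x - f y) <= 1.

Definition level (t : R) : {set V} := [set x | t < f x]%SET.

Definition level_pairs (t : R) : {set V * V} :=
  [set p | [&& p.1 \in level t, p.2 \notin level t & e p.1 p.2]]%SET.

Lemma card_edge_boundary_le t : (#|edge_boundary e (level t)| <= #|level_pairs t|)%N.
Proof.
pose h (p : V * V) := [set p.1; p.2]%SET.
apply: leq_trans (leq_imset_card h (mem (level_pairs t))).
apply/subset_leq_card/fintype.subsetP => _ /imset2P[x y xt /andP[yt exy] ->].
by apply/imsetP; exists (x, y) => //; rewrite inE /= xt yt.
Qed.

(** The drift bound is summed over the level set, which omits [u] because [t >= 0]; drops between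
    two of its vertices cancel by antisymmetry. *)
Lemma level_flow t : 0 <= t ->
  \sum_(p in level_pairs t) (f p.1 - f p.2) <= #|level t|%:R.
Proof.
move=> t0.
have -> : \sum_(p in level_pairs t) (f p.1 - f p.2) =
    \sum_(x in level t) \sum_(y | e x y && (y \notin level t)) (f x - f y).
  rewrite pair_big_dep/=; apply: eq_bigl => -[x y]; rewrite inE/=.
  by rewrite [e x y && _]andbC.
have anti : \sum_(x in level t) \sum_(y | e x y && (y \in level t)) (f x - f y) = 0.
  set S := LHS; suff : S = - S by move/eqP; rewrite -addr_eq0 -mulr2n mulrn_eq0 => /eqP.
  rewrite {1}/S (exchange_big_dep (mem (level t)))/=; last by move=> x y _ /andP[].
  rewrite /S -sumrN; apply: eq_bigr => x xt; rewrite -sumrN; apply: eq_big => [y|y _].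
    by rewrite sym_e xt andbT andbC.
  by rewrite opprB.
rewrite -[leLHS]add0r -[X in X + _ <= _]anti -big_split/= -sum1_card natr_sum.
apply: ler_sum => x xt; rewrite -(bigID (mem (level t)))/=.
apply: drift; apply: contraTneq xt => ->.
by rewrite inE fu -leNgt.
Qed.

(* At most half of the boundary edges carry a drop larger than
   [2 * #|level t| / b], as the total drop is at most [#|level t|]. *)
Lemma level_shrink t (b : R) : 0 <= t -> 0 < b ->
  b <= #|edge_boundary e (level t)|%:R ->
  b / 2 <= d%:R * (#|level t|%:R - #|level (t + 2 * #|level t|%:R / b)|%:R).
Proof.
move=> t0 b0 le_b; set A := level t; set D := 2 * #|A|%:R / b.
have D0 : 0 <= D by rewrite divr_ge0 ?mulr_ge0// ltW.
have subA : level (t + D) \subset A.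
  by apply/fintype.subsetP => x; rewrite !inE; apply: le_lt_trans; rewrite lerDl.
rewrite -natrB ?subset_leq_card// -cardsDS//.
(* Each pair in [high] carries a drop of at least [D]; each pair in [low] starts at a removed
   vertex, and at most [d] start at the same one. *)
pose high := [set p in level_pairs t | p.1 \in level (t + D)]%SET.
pose low := [set p in level_pairs t | p.1 \notin level (t + D)]%SET.
have cardE : #|level_pairs t|%:R = #|high|%:R + #|low|%:R :> R.
  rewrite -natrD -(cardsID [set p | p.1 \in level (t + D)] (level_pairs t)).
  by congr (_ + _)%:R; apply: eq_card => p; rewrite !inE// andbC.
have pairs_ge : b <= #|level_pairs t|%:R.
  by apply: (le_trans le_b); rewrite ler_nat; exact: card_edge_boundary_le.
have A_gt0 : 0 < #|A|%:R :> R.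
  have : 0 < #|level_pairs t|%:R :> R by exact: lt_le_trans b0 pairs_ge.
  rewrite !ltr0n => /card_gt0P[p]; rewrite inE => /and3P[pA _ _].
  by apply/card_gt0P; exists p.1.
have high_le : #|high|%:R * D <= #|A|%:R.
  apply: (le_trans _ (level_flow t0)).
  have -> : #|high|%:R * D =
      \sum_(p in level_pairs t) (if p.1 \in level (t + D) then D else 0).
    rewrite -big_mkcondr /= mulr_natl -sumr_const; apply: eq_bigl => p.
    by rewrite [LHS]inE.
  apply: ler_sum => p; rewrite inE => /and3P[+ + _]; rewrite !inE -leNgt => p1 p2.
  by case: ifP => lt_p; lra.
have low_le : (#|low| <= d * #|A :\: level (t + D)|)%N.
  apply: (@leq_trans (\sum_(x in A :\: level (t + D)) degree e x)%N); last first.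
    rewrite -sum1_card big_distrr/=; apply: leq_sum => x _.
    by rewrite muln1; exact: degree_le.
  rewrite /degree; under eq_bigr do rewrite -sum1_card.
  rewrite pair_big_dep -sum1_card [leqRHS]big_mkcond [leqLHS]big_mkcond.
  apply: leq_sum => -[x y] _; rewrite /= !inE /= -/A.
  by case: (e x y); case: (t < f x); case: (t + D < f x); case: (t < f y).
have : b / 2 <= #|low|%:R.
  (* By the choice of [D], this is [high_le] divided by [D]. *)
  have : #|high|%:R <= b / 2.
    rewrite -(ler_pM2r A_gt0); apply: (@le_trans _ _ (#|high|%:R * D * (b / 2))).
      by rewrite le_eqVlt; apply/orP; left; apply/eqP; rewrite /D; field; rewrite gt_eqF.
    by rewrite [leRHS]mulrC ler_wpM2r// divr_ge0// ltW.
  by lra.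
by move=> /le_trans; apply; rewrite -natrM ler_nat.
Qed.

End level_sets.

(** * Decay of a negative power along the growth of the complement *)

Section decay.
Context {R : realType} (gamma delta eta : R).
Hypotheses (gamma_gt : 1 / 2 < gamma) (gamma_lt : gamma < 1).
Hypotheses (delta_gt0 : 0 < delta) (eta_gt0 : 0 < eta) (eta_le1 : eta <= 1).

Let s : R := 2 * gamma - 1.

Let s01 : 0 < s < 1.
Proof. by rewrite /s; move: gamma_gt gamma_lt => gt lt; apply/andP; split; lra. Qed.

(** Follows from [ln (1 + x) >= x / (1 + x) >= x / 2] and [expR (- y) <= 1 / (1 + y)] with
    [y = c * x / 2]. *)
Lemma powRN_decay (c x : R) : 0 < c < 1 -> 0 <= x <= 1 ->
  (1 + x) `^ (- c) <= 1 - c * x / 4.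
Proof.
move=> /andP[c0 c1] /andP[x0 x1]; have y0 : 0 < 1 + x by lra.
rewrite /powR gt_eqF//.
have lnx : x / 2 <= ln (1 + x).
  have := @le_ln1Dx _ ((1 + x)^-1 - 1).
  rewrite ltrBrDr addNr invr_gt0 y0 subrKC lnV ?posrE// => /(_ isT).
  rewrite lerNl opprB; apply: le_trans.
  have -> : 1 - (1 + x)^-1 = x / (1 + x) by field; rewrite gt_eqF.
  by rewrite ler_wpM2l// lef_pV2 ?posrE//; lra.
apply: (@le_trans _ _ (expR (- (c * x / 2)))).
  by rewrite ler_expR; nra.
have cx : 0 <= c * x <= 1 by apply/andP; split; nra.
rewrite expRN -[leRHS]invrK lef_pV2 ?posrE ?expR_gt0 ?invr_gt0//; last by lra.
apply: le_trans (expR_ge1Dx _).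
rewrite -[leLHS]mul1r ler_pdivrMr; nra.
Qed.

Let C2 : R := 8 / (delta * s * eta).

(** The growth factor is [1 + x] with [x = eta * b^(gamma - 1)], so [b^(- s)] loses at least
    [s * eta / 4 * b^(- gamma)], because [- s + gamma - 1 = - gamma]. [C2] is chosen to make this
    loss worth [2 / delta * b^(- gamma)]. *)
Lemma complement_decay (b b' : R) : 1 <= b -> b + eta * b `^ gamma <= b' ->
  2 / (delta * b `^ gamma) + C2 * b' `^ (- s) <= C2 * b `^ (- s).
Proof.
move=> b1 le_b'; have /andP[s0 s1] := s01; move: gamma_gt gamma_lt => gt lt; have b0 : 0 < b by lra.
have C20 : 0 < C2 by rewrite /C2 divr_gt0// !mulr_gt0.
pose x := eta * b `^ (gamma - 1).
have x01 : 0 <= x <= 1.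
  rewrite /x mulr_ge0 ?powR_ge0 ?(ltW eta_gt0)//=.
  apply: mulr_ile1; rewrite ?powR_ge0 ?(ltW eta_gt0)//.
  rewrite -[leRHS](powRr0 b); apply: ler_powR => //; lra.
have E : b * (1 + x) = b + eta * b `^ gamma.
  by rewrite mulrDr mulr1 /x mulrCA mulr_powRB1 ?(ltW b0)//; lra.
have le1 : b' `^ (- s) <= b `^ (- s) * (1 - s * x / 4).
  apply: (@le_trans _ _ ((b * (1 + x)) `^ (- s))).
    rewrite !powRN lef_pV2 ?posrE ?powR_gt0//; last 2 first.
    - by rewrite (lt_le_trans _ le_b')// ltr_pwDl ?mulr_ge0 ?powR_ge0// ltW.
    - by rewrite E ltr_pwDl ?mulr_ge0 ?powR_ge0// ltW.
    apply: ge0_ler_powR; rewrite ?nnegrE ?E//; first by lra.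
      by rewrite addr_ge0 ?mulr_ge0 ?powR_ge0// ltW.
    by rewrite (le_trans _ le_b')// addr_ge0 ?mulr_ge0 ?powR_ge0// ltW.
  rewrite powRM ?(ltW b0)//; last by have /andP[] := x01; lra.
  by rewrite ler_wpM2l ?powR_ge0// powRN_decay.
have E2 : b `^ (- s) * b `^ (gamma - 1) = (b `^ gamma)^-1.
  rewrite -powRD; last by rewrite (gt_eqF b0) implybT.
  by rewrite -powRN; congr (_ `^ _); rewrite /s; ring.
have : C2 * b' `^ (- s) <= C2 * (b `^ (- s) * (1 - s * x / 4)).
  by rewrite ler_pM2l.
have -> : C2 * (b `^ (- s) * (1 - s * x / 4)) =
   C2 * b `^ (- s) - C2 * s * eta / 4 * (b `^ (- s) * b `^ (gamma - 1)).
  by rewrite /x; field.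
rewrite E2.
have -> : C2 * s * eta / 4 = 2 / delta.
  by rewrite /C2; field; rewrite !gt_eqF.
by rewrite invfM; lra.
Qed.

End decay.

(** * The bound on the function from the isoperimetric inequality *)

Section isoperimetry.
Context {R : realType} (gamma delta eta : R) (d : nat).
Hypotheses (gamma_gt : 1 / 2 < gamma) (gamma_lt : gamma < 1).
Hypotheses (delta_gt0 : 0 < delta) (d_gt0 : (0 < d)%N).
Hypotheses (eta_gt0 : 0 < eta) (eta_le1 : eta <= 1).
Hypothesis eta_le : eta <= delta / (2 * d%:R).
Context {V : finType} (e : rel V) (f : V -> R) (u : V).
Hypothesis sym_e : symmetric e.
Hypothesis degree_le : forall x, (degree e x <= d)%N.
Hypothesis isoperimetric : forall A : {set V}, #|A|%:R <= #|V|%:R / 2 :> R ->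
  delta * #|A|%:R `^ gamma <= #|edge_boundary e A|%:R.
Hypothesis fu : f u = 0.
Hypothesis drift : forall x, x != u -> \sum_(y | e x y) (f x - f y) <= 1.

Local Notation n := (#|V|%:R : R).
Local Notation level := (level f).

Let C1 : R := 2 / (delta * eta).
Let C2 : R := 8 / (delta * (2 * gamma - 1) * eta).

Let C1_gt0 : 0 < C1. Proof. by rewrite divr_gt0 ?mulr_gt0. Qed.

Let C2_gt0 : 0 < C2.
Proof. by rewrite divr_gt0 ?mulr_gt0//; move: gamma_gt => gt; lra. Qed.

(** Lets the isoperimetric hypothesis be used on the complement of a large level set. *)
Lemma edge_boundaryC (A : {set V}) : edge_boundary e (~: A) = edge_boundary e A.
Proof.
apply/setP => a; apply/imset2P/imset2P => -[x y].
  rewrite inE => xA; rewrite inE /= inE negbK => /andP[yA exy] ->.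
  by exists y x; rewrite ?inE ?yA ?xA /= 1?sym_e// finset.setUC.
move=> xA; rewrite inE /= => /andP[yA exy] ->.
by exists y x; rewrite ?inE ?yA ?xA ?negbK /= 1?sym_e// finset.setUC.
Qed.

Let level_decrease t (m : R) : 0 <= t -> 0 < m ->
  delta * m `^ gamma <= #|edge_boundary e (level t)|%:R ->
  #|level (t + 2 * #|level t|%:R / (delta * m `^ gamma))|%:R <=
    #|level t|%:R - eta * m `^ gamma.
Proof.
move=> t0 m0 le_m; have mg : 0 < m `^ gamma by exact: powR_gt0.
have := level_shrink sym_e degree_le fu drift t0 (mulr_gt0 delta_gt0 mg) le_m.
set a' := #|level (t + _)|%:R; set a := #|level t|%:R => H.
have d0 : 0 < d%:R :> R by rewrite ltr0n.
have : delta / (2 * d%:R) * m `^ gamma <= a - a'.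
  rewrite -(ler_pM2l d0); apply: le_trans H.
  by rewrite le_eqVlt; apply/orP; left; apply/eqP; field; rewrite gt_eqF.
have : eta * m `^ gamma <= delta / (2 * d%:R) * m `^ gamma by rewrite ler_pM2r.
lra.
Qed.

Let level0 t x : #|level t| = 0%N -> f x <= t.
Proof.
by move=> /cards0_eq/setP/(_ x); rewrite !inE => /negbT; rewrite -leNgt.
Qed.

(** With [a] the size of the level set, raising [t] by [D = 2 / delta * a^(1 - gamma)] removes at
    least [eta * a^gamma] vertices. As [a >= 1] and [2 * gamma > 1], [D] is at most [C1] times that
    number, so [t + C1 * a] does not increase. *)
Let small_level_bound k t x : 0 <= t -> (#|level t| <= k)%N ->
  #|level t|%:R <= n / 2 -> f x <= t + C1 * #|level t|%:R.
Proof.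
elim: k t => [|k IHk] t t0.
  rewrite leqn0 => /eqP t_eq0 _; rewrite t_eq0 mulr0 addr0.
  exact: level0.
move=> le_k le_n; have [t_eq0|] := posnP #|level t|.
  by rewrite t_eq0 mulr0 addr0; exact: level0.
move=> t_gt0; have a1 : 1 <= #|level t|%:R :> R by rewrite ler1n.
have ag : 1 <= #|level t|%:R `^ gamma.
  by rewrite -[leLHS](powRr0 #|level t|%:R); apply: ler_powR => //; move: gamma_gt => gt; lra.
have a0 : 0 < #|level t|%:R :> R by lra.
have := level_decrease t0 a0 (isoperimetric le_n).
set D := 2 * _ / _; set a := #|level t|%:R in ag a0 a1 le_n D *.
set m := a `^ gamma in ag D * => le_a'.
have m0 : 0 < m by lra.
have D0 : 0 <= D by rewrite divr_ge0 ?mulr_ge0// ltW.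
have lt_a' : #|level (t + D)|%:R < a.
  by apply: (le_lt_trans le_a'); rewrite ltrBlDr ltrDl mulr_gt0//; lra.
have lt_k : (#|level (t + D)| <= k)%N.
  by rewrite -ltnS (leq_trans _ le_k)// -(ltr_nat R).
have := IHk (t + D) (addr_ge0 t0 D0) lt_k (le_trans (ltW lt_a') le_n).
move=> /le_trans; apply.
have : C1 * #|level (t + D)|%:R <= C1 * (a - eta * m) by rewrite ler_pM2l.
have -> : C1 * (a - eta * m) = C1 * a - 2 / delta * m.
  by rewrite /C1; field; rewrite !gt_eqF.
suff : D <= 2 / delta * m by lra.
have am : a <= m * m.
  rewrite /m -powRD; last by rewrite (gt_eqF a0) implybT.
  by rewrite -[leLHS](powRr1 (ltW a0)); apply: ler_powR => //; move: gamma_gt => gt; lra.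
rewrite /D ler_pdivrMr; last by rewrite mulr_gt0//; lra.
have -> : 2 / delta * m * (delta * m) = 2 * (m * m) by field; rewrite gt_eqF.
by rewrite ler_pM2l.
Qed.

(** Here the quantity that does not increase is [t + n * C2 * b^(- s)], with [b] the size of the
    complement; the reserve [C1 * n] pays for the phase of small level sets. *)
Let large_level_bound k t x : 0 <= t -> (#|level t| <= k)%N ->
  n / 2 < #|level t|%:R ->
  f x <= t + n * (C2 * (n - #|level t|%:R) `^ (- (2 * gamma - 1))) + C1 * n.
Proof.
elim: k t => [|k IHk] t t0.
  by rewrite leqn0 => /eqP ->; rewrite ltNge divr_ge0.
move=> le_k lt_n.
set s := 2 * gamma - 1; set a : R := #|level t|%:R in lt_n *.
have cardC : n - a = #|~: level t|%:R by rewrite -(cardsC (level t)) natrD addrC addKr.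
(* The complement contains [u], as [f u = 0 <= t]. *)
have b1 : 1 <= n - a.
  by rewrite cardC ler1n; apply/card_gt0P; exists u; rewrite !inE fu -leNgt.
have b_le : #|~: level t|%:R <= n / 2 by rewrite -cardC; lra.
have := isoperimetric b_le; rewrite edge_boundaryC -cardC.
set b := n - a in b1 * => le_b.
have b0 : 0 < b by lra.
have mg : 0 < b `^ gamma by exact: powR_gt0.
have := level_decrease t0 b0 le_b.
rewrite -/a; set m := b `^ gamma in mg *; set D := 2 * _ / _ => le_a'.
have a0 : 0 <= a by exact: ler0n.
have a_n : a <= n by rewrite ler_nat max_card.
have D0 : 0 <= D by rewrite divr_ge0 ?mulr_ge0// ltW.
have D_le : D <= n * (2 / (delta * m)).
  by rewrite /D mulrA [n * 2]mulrC ler_pM2r ?invr_gt0 ?mulr_gt0// ler_pM2l.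
have em : 0 < eta * m by rewrite mulr_gt0.
have [small|large] := lerP #|level (t + D)|%:R (n / 2).
  have := small_level_bound x (addr_ge0 t0 D0) (leqnn _) small.
  move=> /le_trans; apply.
  have : C1 * #|level (t + D)|%:R <= C1 * n by rewrite ler_pM2l// ler_nat max_card.
  suff : D <= n * (C2 * b `^ (- s)) by lra.
  apply: (le_trans D_le); apply: ler_wpM2l => //.
  (* Only the cost of this last increment matters here, so [b'] is set to its lower bound and its
     nonnegative term is discarded. *)
  have := @complement_decay _ gamma delta eta gamma_gt gamma_lt delta_gt0 eta_gt0 eta_le1
    b (b + eta * b `^ gamma) b1 (lexx _).
  rewrite -/s -/C2 -/m; apply: le_trans; rewrite lerDl.
  by rewrite mulr_ge0 ?powR_ge0// ltW.
have lt_k : (#|level (t + D)| <= k)%N.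
  by rewrite -ltnS (leq_trans _ le_k)// -(ltr_nat R) (le_lt_trans le_a')// -/a; lra.
have := IHk (t + D) (addr_ge0 t0 D0) lt_k large.
move=> /le_trans; apply; rewrite lerD2r -addrA lerD2l.
have := @complement_decay _ gamma delta eta gamma_gt gamma_lt delta_gt0 eta_gt0 eta_le1
  b (n - #|level (t + D)|%:R) b1.
rewrite -/s -/C2 -/m => /(_ _)/(ler_wpM2l (ler0n R #|V|)).
rewrite mulrDr; move=> H; apply: (le_trans _ (H _)); first by rewrite lerD2r.
by rewrite /b; lra.
Qed.

(** Both phases start at level 0; in the large case [b >= 1] gives [b^(- s) <= 1]. *)
Lemma isoperimetric_bound x : f x <= (C1 + C2) * n.
Proof.
have n0 : 0 <= n by exact: ler0n.
have le_n : #|level 0|%:R <= n by rewrite ler_nat max_card.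
have [small|large] := lerP #|level 0|%:R (n / 2).
  apply: (le_trans (small_level_bound x (lexx _) (leqnn _) small)).
  by rewrite add0r mulrDl -[leLHS]addr0 lerD ?ler_pM2l// mulr_ge0// ltW.
apply: (le_trans (large_level_bound x (lexx _) (leqnn _) large)).
rewrite add0r [leRHS]mulrDl [leRHS]addrC lerD2r mulrC; apply: ler_wpM2r => //.
rewrite -[leRHS]mulr1 ler_pM2l//.
have b1 : 1 <= n - #|level 0|%:R.
  have -> : n - #|level 0|%:R = #|~: level 0|%:R by rewrite -(cardsC (level 0)) natrD addrC addKr.
  by rewrite ler1n; apply/card_gt0P; exists u; rewrite !inE fu -leNgt.
rewrite -[leRHS](powRr0 (n - #|level 0|%:R)); apply: ler_powR => //.
by move: gamma_gt => gt; lra.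
Qed.

End isoperimetry.

(** * From the Green function to the maximal commute time *)

Lemma mean_hitting_time_self (R : realType) (V : finType) (e : rel V)
    (disp : measure_display) (Om : measurableType disp) (P : probability Om R)
    (xi : {set V} * nat -> {RV P >-> R}) (u : V) :
  (mean_hitting_time e xi u u <= 0)%E.
Proof.
apply: (le_trans (le_ge0_integral (g := cst 0%E) P _ _)) => //; last by rewrite integral0.
by move=> w; apply: ereal_inf_lbound; exists 0%N.
Qed.

Theorem mainTheorem2 (R : realType) (gamma delta : R) (d : nat)
    (gamma_gt : 1 / 2 < gamma) (gamma_lt : gamma < 1)
    (delta_gt0 : 0 < delta) (d_gt0 : (0 < d)%N) :
  exists K : R,
    forall (V : finType) (e : rel V) (k : nat),
      symmetric e -> irreflexive e ->
      (forall x, degree e x = k) -> (k <= d)%N ->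
      (forall A : {set V}, #|A|%:R <= #|V|%:R / 2 :> R ->
         delta * #|A|%:R `^ gamma <= #|edge_boundary e A|%:R) ->
      forall (disp : measure_display) (Om : measurableType disp)
        (P : probability Om R) (xi : {set V} * nat -> {RV P >-> R}),
        alarm_clocks e xi ->
        (max_mean_commute_time e xi <= (K * #|V|%:R)%:E)%E.
Proof.
(* The first term comes from [level_shrink]; the cap 1 keeps [eta * b^(gamma - 1)] at most 1 in
   [complement_decay]. *)
pose eta : R := Num.min (delta / (2 * d%:R)) 1.
have eta_gt0 : 0 < eta by rewrite lt_min ltr01 divr_gt0// mulr_gt0// ltr0n.
have eta_le1 : eta <= 1 by rewrite ge_min lexx orbT.
have eta_le : eta <= delta / (2 * d%:R) by rewrite ge_min lexx.
pose C : R := 2 / (delta * eta) + 8 / (delta * (2 * gamma - 1) * eta).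
have C0 : 0 <= C.
  rewrite addr_ge0 ?divr_ge0 ?mulr_ge0// ?ltW//; first lra.
(* Each of the two hitting times of a commute costs [4 * C * #|V|]. *)
exists (8 * C) => V e k sym_e irr_e degE k_le iso disp Om P xi clocks.
have degree_le x : (degree e x <= d)%N by rewrite degE.
have le_hit u v : (mean_hitting_time e xi u v <= (4 * (C * #|V|%:R))%:E)%E.
  have [<-|vu] := eqVneq u v.
    by apply: (le_trans (mean_hitting_time_self _ _ _)); rewrite lee_fin !mulr_ge0.
  have edges_gt0 : (0 < #|edges e|)%N.
    (* With two distinct vertices a singleton is at most half of the graph, so it has a boundary
       edge. *)
    have : delta * #|[set u]%SET|%:R `^ gamma <= #|edge_boundary e [set u]%SET|%:R.
      apply: iso; rewrite cards1 ler_pdivlMr// mul1r ler_nat.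
      by apply/card_gt1P; exists u, v.
    rewrite cards1 powR1 mulr1 => /(lt_le_trans delta_gt0).
    rewrite ltr0n => /card_gt0P[_ /imset2P[x y _ /andP[_ exy] _]].
    by apply/card_gt0P; exists [set x; y]%SET; exact: edge_in.
  apply: mean_hitting_time_le => // M.
  (* Divided by the number of edges, the sum is [green e v M u], bounded uniformly in [M]. *)
  rewrite -ler_pdivrMr ?ltr0n// mulr_suml.
  exact: (isoperimetric_bound gamma_gt gamma_lt delta_gt0 d_gt0 eta_gt0 eta_le1 eta_le
    sym_e degree_le iso (@green_root _ _ e v M)
    (fun x => @green_drift _ _ _ irr_e v M x edges_gt0)).
rewrite /max_mean_commute_time; apply: bigmax_le => [|p _]; first exact: leNye.
have -> : 8 * C * #|V|%:R = 4 * (C * #|V|%:R) + 4 * (C * #|V|%:R) by ring.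
by rewrite EFinD leeD.
Qed.
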